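(* Let $1\le n\le N$. Every valuation $\mu:\mathcal{T}^n\to\mathbb{R}$ has a unique extension to a valuation on $\mathcal{Q}^n$; that is, there is exactly one valuation $\bar\mu:\mathcal{Q}^n\to\mathbb{R}$ with $\bar\mu(T)=\mu(T)$ for all $T\in\mathcal{T}^n$.
   Context: A polytope is the compact convex hull of finitely many points in $\mathbb{R}^N$. $\mathcal{T}^n$ is the set of simplices of dimension at most $n$ in $\mathbb{R}^N$ (simplices being convex hulls of finitely many affinely independent points), including the empty set. $\mathcal{Q}^n$ is the set of polyhedra of dimension at most $n$ in $\mathbb{R}^N$, i.e. the finite unions of polytopes of dimension at most $n$ (possibly of different dimensions), including the empty set. A function $\mu:\mathcal{S}\to\mathbb{R}$ defined on a class $\mathcal{S}$ of sets is called a valuation if $\mu(\emptyset)=0$, where $\emptyset$ is the empty set, and $$\mu(S)+\mu(T)=\mu(S\cup T)+\mu(S\cap T)$$ for all $S,T\in\mathcal{S}$ such that $S\cup T\in\mathcal{S}$ and $S\cap T\in\mathcal{S}$ as well. *)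

(* Defs.v *)
From mathcomp Require Import all_boot all_order all_algebra.
From mathcomp Require Import boolp classical_sets functions reals.

Set Implicit Arguments.
Unset Strict Implicit.
Unset Printing Implicit Defensive.

Import Order.TTheory GRing.Theory Num.Theory.
Local Open Scope classical_set_scope.
Local Open Scope ring_scope.

Section Polyhedra.
Variables (R : realType) (N : nat).
Local Notation V := 'rV[R]_N.

(* The empty family ([k = 0]) has an empty hull, since its weights cannot sum
   to 1. *)
Definition conv_hull (k : nat) (v : 'I_k -> V) : set V :=
  [set x | exists w : 'I_k -> R,
    [/\ forall i, 0 <= w i, \sum_i w i = 1 & x = \sum_i w i *: v i]].

Definition affinely_independent (k : nat) (v : 'I_k -> V) : Prop :=
  forall w : 'I_k -> R,
    \sum_i w i = 0 -> \sum_i w i *: v i = 0 -> forall i, w i = 0.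

Definition affine_hull (A : set V) : set V :=
  [set x | exists (k : nat) (v : 'I_k -> V) (w : 'I_k -> R),
    [/\ forall i, A (v i), \sum_i w i = 1 & x = \sum_i w i *: v i]].

(* The dimension of a set is that of its affine hull, i.e. the dimension of
   the linear subspace [U] of which the affine hull is a translate; the empty
   set has dimension at most [n] for every [n : nat]. *)
Definition dim_le (n : nat) (A : set V) : Prop :=
  A = set0 \/
  exists (p : V) (U : {vspace V}),
    affine_hull A = [set x | x - p \in U] /\ (\dim U <= n)%N.

Definition polytope (A : set V) : Prop :=
  exists (k : nat) (v : 'I_k -> V), A = conv_hull v.

Definition simplex (A : set V) : Prop :=
  exists (k : nat) (v : 'I_k -> V),
    affinely_independent v /\ A = conv_hull v.

(* Contains [set0], the hull of the empty family. *)
Definition simplices (n : nat) : set (set V) :=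
  [set A | simplex A /\ dim_le n A].

(* Contains [set0], the union of the empty family. *)
Definition polyhedra (n : nat) : set (set V) :=
  [set A | exists (m : nat) (P : 'I_m -> set V),
    (forall i, polytope (P i) /\ dim_le n (P i)) /\
    A = \bigcup_(i in [set: 'I_m]) P i].

Lemma simplices_set0 (n : nat) : simplices n set0.
Proof.
split; last by left.
exists 0%N, (fun=> 0); split; first by move=> w _ _ [].
apply/esym; rewrite -subset0 => x [w [_]].
by rewrite big_ord0 => /eqP; rewrite eq_sym oner_eq0.
Qed.

Lemma polyhedra_set0 (n : nat) : polyhedra n set0.
Proof.
exists 0%N, (fun=> set0); split; first by case.
by rewrite bigcup0.
Qed.

Lemma simplices_sub_polyhedra (n : nat) : simplices n `<=` polyhedra n.
Proof.
move=> A [[k [v [_ Av]]] dimA].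
exists 1%N, (fun=> A); split; first by move=> _; split=> //; exists k, v.
by rewrite bigcup_const //; exists ord0.
Qed.

(* [mu] is defined on the members of [S] only: [S] is coerced to the type
   [{A | A \in S}]. *)
Definition valuation (S : set (set V)) (mu : S -> R) : Prop :=
  (forall S0 : set0 \in S, mu (SigSub S0) = 0) /\
  (forall (A B : S) (SU : val A `|` val B \in S) (SI : val A `&` val B \in S),
     mu A + mu B = mu (SigSub SU) + mu (SigSub SI)).

Definition simplex_polyhedron (n : nat) (T : simplices n) : polyhedra n :=
  SigSub (mem_set (simplices_sub_polyhedra (set_valP T))).

End Polyhedra.

(* Main.v *)
Require Import Defs.
From HB Require Import structures.
From mathcomp Require Import all_boot all_order all_algebra.
From mathcomp Require Import boolp classical_sets functions reals.
From mathcomp Require Import perm ring lra zify.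

(* Send a simplex [S] to the pair [gen S] of its indicator function and its
   value [mu S]; let [chains k] be the group generated by the pairs of the
   simplices with at most [k] vertices. Everything rests on the fact that
   [(0, t)] belongs to [chains n.+1] only for [t = 0]: the extension is then
   forced to be the unique [t] such that the indicator of the polyhedron,
   paired with [t], is in [chains n.+1].

   The fact is proved by induction on the number of vertices, working modulo
   [chains k] with simplices on [k + 1] vertices. There the defining property
   of valuations says that a simplex cut through a point of one of its edges is
   the sum of its two halves. It implies that for an affine dependency
   [sum_i a_i p_i = 0] of [k + 2] points the simplices [p \ p_i], weighted by
   the signs of the [a_i], sum to [0] ([radon_split]). Applied to the vertices of
   a simplex and one more point [o] of its affine hull, this writes the simplex
   as a signed sum of cones over its facets with apex [o]. In a combination of
   simplices whose indicator functions cancel, the facets, with these signs,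
   cancel again, which makes an induction on the dimension possible
   ([chain_vanish]). Cancellation is tested there at infinitesimal positions,
   given by a basis taken in lexicographic order ([lexcone]), so that
   lower-dimensional faces do not interfere.

   That indicators of polyhedra are combinations of indicators of simplices,
   and that valuations on polyhedra are determined by their values on simplices,
   both follow from [good_capsP], which cuts a simplex by hyperplanes, one edge
   at a time, until each piece lies on one side of every hyperplane. *)

Set Implicit Arguments.
Unset Strict Implicit.
Unset Printing Implicit Defensive.

Import Order.TTheory GRing.Theory Num.Theory.
Local Open Scope classical_set_scope.
Local Open Scope ring_scope.

(** * Families of vectors and lexicographic cones *)

Section Families.
Variables (R : realType) (E : lmodType R).

Definition comb k (w : 'I_k -> R) (p : 'I_k -> E) : E := \sum_i w i *: p i.

Definition lfree k (p : 'I_k -> E) := forall w, comb w p = 0 -> forall i, w i = 0.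

Definition inspan k (p : 'I_k -> E) (x : E) := exists w, x = comb w p.

Definition cone k (p : 'I_k -> E) : set E :=
  [set x | exists w, (forall i, 0 <= w i) /\ x = comb w p].

Definition fcons T k (x : T) (p : 'I_k -> T) (i : 'I_k.+1) : T :=
  if unlift ord0 i is Some j then p j else x.

Definition del T k (p : 'I_k.+1 -> T) (i : 'I_k.+1) (j : 'I_k) : T := p (lift i j).

Lemma fcons0 T k (x : T) (p : 'I_k -> T) : fcons x p ord0 = x.
Proof. by rewrite /fcons unlift_none. Qed.

Lemma fconsS T k (x : T) (p : 'I_k -> T) j : fcons x p (lift ord0 j) = p j.
Proof. by rewrite /fcons liftK. Qed.

Lemma comb_fcons k w0 (w : 'I_k -> R) x p :
  comb (fcons w0 w) (fcons x p) = w0 *: x + comb w p.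
Proof.
rewrite /comb big_ord_recl !fcons0; congr (_ + _).
by apply: eq_bigr => i _; rewrite !fconsS.
Qed.

Lemma comb_recl k (w : 'I_k.+1 -> R) x p :
  comb w (fcons x p) = w ord0 *: x + comb (del w ord0) p.
Proof.
rewrite /comb big_ord_recl !fcons0; congr (_ + _).
by apply: eq_bigr => i _; rewrite !fconsS.
Qed.

Lemma del_fconsS T k (x : T) (p : 'I_k.+1 -> T) i :
  del (fcons x p) (lift ord0 i) = fcons x (del p i).
Proof.
apply/funext => j; rewrite /del; case: (unliftP ord0 j) => [j'|] ->.
  rewrite fconsS (_ : lift _ _ = lift ord0 (lift i j')) ?fconsS //.
  by apply: val_inj; rewrite /= /bump /=; lia.
rewrite fcons0 (_ : lift _ _ = ord0) ?fcons0 //.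
by apply: val_inj; rewrite /= /bump /=; lia.
Qed.

Lemma del_fcons0 T k (x : T) (p : 'I_k -> T) : del (fcons x p) ord0 = p.
Proof. by apply/funext => j; rewrite /del fconsS. Qed.

Lemma comb_del k (w : 'I_k.+1 -> R) p i :
  comb w p = w i *: p i + comb (del w i) (del p i).
Proof.
rewrite /comb (bigD1_ord i) //=.
Qed.

Lemma combN k w (p : 'I_k -> E) : comb (fun i => - w i) p = - comb w p.
Proof. by rewrite /comb -sumrN; apply: eq_bigr => i _; rewrite scaleNr. Qed.

Lemma combD k w w' (p : 'I_k -> E) :
  comb (fun i => w i + w' i) p = comb w p + comb w' p.
Proof. by rewrite /comb -big_split; apply: eq_bigr => i _; rewrite scalerDl. Qed.

Lemma combZ k x w (p : 'I_k -> E) : comb (fun i => x * w i) p = x *: comb w p.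
Proof. by rewrite /comb scaler_sumr; apply: eq_bigr => i _; rewrite scalerA. Qed.

Lemma comb_delta k (p : 'I_k -> E) i : comb (fun j => (j == i)%:R) p = p i.
Proof.
rewrite /comb (bigD1 i) //= eqxx scale1r big1 ?addr0 // => j /negPf ->.
by rewrite scale0r.
Qed.

Lemma lfree_inj k (p : 'I_k -> E) w w' : lfree p -> comb w p = comb w' p -> w = w'.
Proof.
move=> pf e; apply/funext => i; apply/eqP; rewrite -subr_eq0; apply/eqP.
by apply: (pf (fun i => w i + - w' i)); rewrite combD combN e subrr.
Qed.

Lemma lfree_del k (p : 'I_k.+1 -> E) i : lfree p -> lfree (del p i).
Proof.
move=> pf w e j; pose w' l := if unlift i l is Some l' then w l' else 0.
have -> : w j = w' (lift i j) by rewrite /w' liftK.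
apply: pf; rewrite (comb_del _ _ i) {1}/w' unlift_none scale0r add0r -e.
by congr comb; apply/funext => l; rewrite /del /w' liftK.
Qed.

Lemma inspan_del k (p : 'I_k.+1 -> E) i x : inspan (del p i) x ->
  exists w, x = comb w p /\ w i = 0.
Proof.
move=> [w ->]; pose w' l := if unlift i l is Some l' then w l' else 0.
have w'i : w' i = 0 by rewrite /w' unlift_none.
exists w'; split=> //; rewrite (comb_del _ _ i) w'i scale0r add0r.
by congr comb; apply/funext => l; rewrite /del /w' liftK.
Qed.

Lemma inspan_comb k l (p : 'I_k -> E) (q : 'I_l -> E) w :
  (forall i, inspan q (p i)) -> inspan q (comb w p).
Proof.
move=> /choice[L HL]; exists (fun j => \sum_i w i * L i j).
rewrite /comb; under eq_bigr do rewrite HL /comb scaler_sumr.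
rewrite exchange_big; apply: eq_bigr => j _ /=.
by rewrite scaler_suml; apply: eq_bigr => i _; rewrite scalerA.
Qed.

Lemma inspanN k (p : 'I_k -> E) x : inspan p x -> inspan p (- x).
Proof. by move=> [w ->]; exists (fun i => - w i); rewrite combN. Qed.

Lemma lfree_fcons k (p : 'I_k -> E) x : lfree p -> ~ inspan p x -> lfree (fcons x p).
Proof.
move=> pf xp w; rewrite comb_recl => e.
have w0 : w ord0 = 0.
  apply: contra_notP xp => /eqP w0; exists (fun i => - (w ord0)^-1 * del w ord0 i).
  rewrite combZ; apply: (scalerI w0); rewrite scalerA mulrN divff // scaleN1r.
  by apply/eqP; rewrite -addr_eq0; apply/eqP.
move: e; rewrite w0 scale0r add0r => /pf dw i.
by case: (unliftP ord0 i) => [j|] ->; [exact: dw|].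
Qed.

(** The [m] by [k] coefficient matrix has rank at most [k], so its left kernel contains a nonzero
    row: a dependency of [q]. *)
Lemma not_lfree_span k m (p : 'I_k -> E) (q : 'I_m -> E) : (k < m)%N ->
  (forall i, inspan p (q i)) -> ~ lfree q.
Proof.
move=> km /choice[L HL] qf.
pose A := \matrix_(i < m, j < k) L i j.
have : kermx A != 0.
  rewrite -mxrank_eq0 mxrank_ker subn_eq0 -ltnNge.
  exact: leq_ltn_trans (rank_leq_col _) km.
move=> /rowV0Pn[u /sub_kermxP uA /eqP]; apply; apply/rowP => i; rewrite mxE.
apply: (qf (fun i => u 0 i)); rewrite /comb.
under eq_bigr do rewrite HL /comb scaler_sumr.
rewrite exchange_big big1 //= => j _.
move/rowP: uA => /(_ j); rewrite !mxE => uA.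
rewrite -[RHS](scale0r (p j)) -uA scaler_suml.
by apply: eq_bigr => l _; rewrite mxE scalerA.
Qed.

(* The sign is that of the nonzero entry of largest index. *)
Definition lexpos k (f : 'I_k -> R) :=
  exists j, 0 < f j /\ forall j' : 'I_k, (j < j')%N -> f j' = 0.

Lemma lexpos_fcons k x (f : 'I_k -> R) :
  lexpos (fcons x f) <-> lexpos f \/ ((forall j, f j = 0) /\ 0 < x).
Proof.
split.
  move=> [j []]; case: (unliftP ord0 j) => [j'|] -> {j}.
    rewrite fconsS => fj' z; left; exists j'; split=> // l jl.
    by have := z (lift ord0 l); rewrite fconsS; apply; rewrite /= /bump.
  rewrite fcons0 => x0 z; right; split=> // l.
  by have := z (lift ord0 l); rewrite fconsS; apply.
move=> [[j [fj z]]|[z x0]].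
  exists (lift ord0 j); rewrite fconsS; split=> // l.
  case: (unliftP ord0 l) => [l'|] -> //; rewrite fconsS => jl; apply: z.
  by move: jl; rewrite /= /bump; lia.
exists ord0; rewrite fcons0; split=> // l.
by case: (unliftP ord0 l) => [l'|] ->; rewrite ?ltnn // fconsS.
Qed.

Lemma lexpos_or k (f : 'I_k -> R) :
  [\/ forall j, f j = 0, lexpos f | lexpos (fun j => - f j)].
Proof.
elim: k f => [|k IH] f; first by apply: Or31; case.
have -> : f = fcons (f ord0) (del f ord0).
  by apply/funext => i; case: (unliftP ord0 i) => [j|] ->; rewrite ?fconsS ?fcons0.
set x := f ord0; set g := del f ord0.
have -> : (fun j => - fcons x g j) = fcons (- x) (fun j => - g j).
  by apply/funext => i; case: (unliftP ord0 i) => [j|] ->; rewrite ?fconsS ?fcons0.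
case: (IH g) => [g0|gp|gn].
- case: (ltrgt0P x) => x0.
  + by apply: Or32; apply/lexpos_fcons; right.
  + apply: Or33; apply/lexpos_fcons; right; rewrite oppr_gt0; split=> // j.
    by rewrite g0 oppr0.
  + by apply: Or31 => i; case: (unliftP ord0 i) => [j|] ->; rewrite ?fconsS ?fcons0.
- by apply: Or32; apply/lexpos_fcons; left.
- by apply: Or33; apply/lexpos_fcons; left.
Qed.

(* For infinitesimals [1 >> e_1 >> e_2 >> ...], the open cone over [s] contains
   [b_(l-1) + e_1 b_(l-2) + e_2 b_(l-3) + ...]. *)
Definition lexcone k l (s : 'I_k -> E) (b : 'I_l -> E) :=
  exists L : 'I_l -> 'I_k -> R,
    (forall j, b j = comb (L j) s) /\ forall i, lexpos (fun j => L j i).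

Lemma lexcone_inspan k l (s : 'I_k -> E) (b : 'I_l -> E) j :
  lexcone s b -> inspan s (b j).
Proof. by move=> [L [HL _]]; exists (L j). Qed.

Lemma lexconeE k l (s : 'I_k -> E) (b : 'I_l -> E) L : lfree s ->
  (forall j, b j = comb (L j) s) -> lexcone s b <-> forall i, lexpos (fun j => L j i).
Proof.
move=> sf HL; split=> [[L' [HL']]|]; last by exists L.
suff -> : L' = L by [].
by apply/funext => j; apply: (lfree_inj sf); rewrite -HL.
Qed.

(** If two coordinates vanished on all of [b], these [k] free vectors would lie in the span of
    [k - 1] vectors. *)
Lemma lfree_coord_neq0 k (s : 'I_k.+1 -> E) (b : 'I_k -> E) L i i0 :
  lfree b -> (forall j, b j = comb (L j) s) -> i != i0 ->
  (forall j, L j i0 = 0) -> ~ forall j, L j i = 0.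
Proof.
case: (unliftP i0 i) => [i'|] -> {i}; last by rewrite eqxx.
case: k s b L i0 i' => [|k] s b L i0 i' bf HL; first by case: i'.
move=> _ z zi; apply: (@not_lfree_span _ _ (del (del s i0) i') b) => // j.
exists (del (del (L j) i0) i').
rewrite HL (comb_del _ _ i0) z scale0r add0r (comb_del _ _ i') {1}/del zi.
by rewrite scale0r add0r.
Qed.

(** Crossing a facet: the new vector enters at index 0, the least significant place, so it decides
    only at a coordinate that vanishes on all of [b]. As [b] is free there is at most one such [i0],
    and membership then changes by the sign of [a i0], provided [b] lies in the cone of the facet
    opposite to [i0]. *)
Lemma jump k (s : 'I_k.+1 -> E) (b : 'I_k -> E) a : lfree s -> lfree b ->
  (`[< lexcone s (fcons (comb a s) b) >] : int) -
    (`[< lexcone s (fcons (- comb a s) b) >] : int) =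
  \sum_i sgz (a i) * (`[< lexcone (del s i) b >] : int).
Proof.
move=> sf bf.
have [bs|] := pselect (forall j, inspan s (b j)); last first.
  move=> /existsNP[j bj].
  have no x : lexcone s (fcons x b) -> False.
    by move=> /(lexcone_inspan (lift ord0 j)); rewrite fconsS.
  rewrite !(asboolF (@no _)) subrr big1 // => i _.
  rewrite asboolF ?mulr0 // => /(lexcone_inspan j) /inspan_del[w [e _]].
  by apply: bj; exists w.
move/choice: bs => [L HL].
have HLp x w : x = comb w s -> forall j, fcons x b j = comb (fcons w L j) s.
  by move=> -> j; case: (unliftP ord0 j) => [j'|] ->; rewrite ?fconsS ?fcons0.
have fconsE w i : (fun j => fcons w L j i) = fcons (w i) (fun j => L j i).
  by apply/funext => j; case: (unliftP ord0 j) => [j'|] ->; rewrite ?fconsS ?fcons0.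
have posE x w : x = comb w s -> lexcone s (fcons x b) <->
    forall i, lexpos (fcons (w i) (fun j => L j i)).
  move=> e; rewrite (lexconeE sf (HLp _ _ e)).
  by split=> h i; move: (h i); rewrite fconsE.
have posE1 := posE _ _ erefl.
have posE2 := posE _ (fun i => - a i) (esym (combN a s)).
have delz i : lexcone (del s i) b -> forall j, L j i = 0.
  move=> h j; have [w [e wi]] := inspan_del (lexcone_inspan j h).
  by move: e; rewrite HL => /(lfree_inj sf) ->.
(* If no coordinate vanishes on [b], the sign of [a] never matters and no facet spans [b]: both
   sides are 0. *)
have [[i0 z]|nz] := pselect (exists i, forall j, L j i = 0); last first.
  rewrite [RHS]big1; last first.
    by move=> i _; rewrite asboolF ?mulr0 // => /delz h; apply: nz; exists i.
  apply/eqP; rewrite subr_eq0; apply/eqP; congr (nat_of_bool _)%:Z.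
  apply: asbool_equiv_eq.
  rewrite posE1 posE2; split=> h i; apply/lexpos_fcons; left;
    by move/lexpos_fcons: (h i) => [//|[h' _]]; case: nz; exists i.
have HL' j : b j = comb (del (L j) i0) (del s i0).
  by rewrite HL (comb_del _ _ i0) z scale0r add0r.
have nz i (ii0 : i != i0) := lfree_coord_neq0 bf HL ii0 z.
rewrite (bigD1 i0) //= [in X in _ = X]big1 ?addr0; last first.
  by move=> i ii0; rewrite asboolF ?mulr0 // => /delz; apply: nz.
have posD := lexconeE (lfree_del sf) HL'.
have key w : (forall i, lexpos (fcons (w i) (fun j => L j i))) <->
    lexcone (del s i0) b /\ 0 < w i0.
  rewrite posD; split=> [h|[h w0] i].
    split=> [i|].
      move/lexpos_fcons: (h (lift i0 i)) => [//|[h' _]].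
      by case: (nz (lift i0 i)); rewrite // eq_sym neq_lift.
    by move/lexpos_fcons: (h i0) => [[j [+ _]]|[_ //]]; rewrite z ltxx.
  apply/lexpos_fcons; case: (unliftP i0 i) => [i'|] ->; last by right.
  by left; apply: h.
rewrite (asbool_equiv_eq (posE1 _)) (asbool_equiv_eq posE2).
rewrite (asbool_equiv_eq (key a)) (asbool_equiv_eq (key (fun i => - a i))).
have [hp|hp] := pselect (lexcone (del s i0) b); last first.
  by rewrite !(asboolF hp) !asboolF ?mulr0 // => -[].
rewrite (asboolT hp) mulr1.
have tE w : (`[< lexcone (del s i0) b /\ 0 < w >]) = (0 < w).
  by apply/asboolP/idP => [[]|].
rewrite !tE oppr_gt0; case: sgzP => //.
Qed.

End Families.

(** * Vanishing of signed sums of simplices whose lexicographic cones cancel *)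

Section Chains.
Variables (R : realType) (E : lmodType R) (W : zmodType) (M : zmodClosed W).
Variable Q : E -> Prop.

Lemma sum_del_fcons k (Phi : ('I_k.+1 -> E) -> W) (x : E) p (c : R) a :
  \sum_i Phi (del (fcons x p) i) *~ sgz (fcons c a i) =
  Phi p *~ sgz c + \sum_i Phi (fcons x (del p i)) *~ sgz (a i).
Proof.
rewrite big_ord_recl del_fcons0 fcons0; congr (_ + _).
by apply: eq_bigr => i _; rewrite del_fconsS fconsS.
Qed.

(** The simplices are grouped by span. In each group all are rewritten, modulo [M], as signed cones
    over their facets with a common apex [o]. By [jump] the facets cancel at every [b], so the
    induction applies to [Phi] with [o] prepended. *)
Lemma chain_vanish k (Phi : ('I_k -> E) -> W)
    (Phi_radon : forall (p : 'I_k.+1 -> E) a, (forall i, Q (p i)) -> comb a p = 0 ->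
      \sum_i Phi (del p i) *~ sgz (a i) \in M)
    (J : finType) (n : J -> int) (s : J -> 'I_k -> E) :
  (forall j, lfree (s j)) -> (forall j i, Q (s j i)) ->
  (forall b : 'I_k -> E, lfree b ->
     \sum_j n j * (`[< lexcone (s j) b >] : int) = 0) ->
  \sum_j Phi (s j) *~ n j \in M.
Proof.
elim: k Phi Phi_radon J n s => [|k IH] Phi Phi_radon J n s sf sQ s0.
  (* There is only one empty family, and the hypothesis at this [b] says that the [n j] sum to 0. *)
  pose b : 'I_0 -> E := fun=> 0.
  have e j : s j = b by apply/funext => -[].
  under eq_bigr do rewrite e.
  rewrite -mulrz_sumr; set x := \sum_j _; suff -> : x = 0 by rewrite mulr0z rpred0.
  rewrite -(s0 b); last by move=> ? ? [].
  apply: eq_bigr => j _; rewrite asboolT ?mulr1 // e.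
  by exists (fun _ => fun i => 0); split; case.
(* [rep] selects one index in each class of simplices with equal span. *)
pose same j : pred J := fun j' => `[< inspan (s j) = inspan (s j') >].
pose rep j := odflt j [pick j' | same j j'].
have rep_span j : inspan (s (rep j)) = inspan (s j).
  rewrite /rep; case: pickP => [j' /asboolP //|/(_ j)].
  by rewrite /same asboolT.
have rep_eq j j' : inspan (s j) = inspan (s j') -> rep j = rep j'.
  move=> e; have e' : same j =1 same j' by move=> l; rewrite /same e.
  rewrite /rep -(eq_pick e'); case: pickP => [//|/(_ j)].
  by rewrite /same asboolT.
rewrite (partition_big rep predT) //=; apply: rpred_sum => j0 _.
have [j1 j1P|none] := pickP (fun j => rep j == j0); last first.
  by rewrite big_pred0 ?rpred0.
have span1 j : rep j == j0 -> inspan (s j) = inspan (s j1).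
  by move=> /eqP jj; rewrite -rep_span jj -(eqP j1P) rep_span.
pose n1 j := if rep j == j0 then n j else 0.
rewrite big_mkcond /=.
rewrite (eq_bigr (fun j => Phi (s j) *~ n1 j)); last first.
  by move=> j _; rewrite /n1; case: ifP.
(* Cancellation holds within one class: [k.+1] free vectors in the span of [s j] are a basis of it,
   so all simplices whose cones contain [b] have the same span. *)
have {s0} s1 (b : 'I_k.+1 -> E) : lfree b ->
    \sum_j n1 j * (`[< lexcone (s j) b >] : int) = 0.
  move=> bf; have [[j [jj jb]]|nb] := pselect (exists j, rep j = j0 /\ lexcone (s j) b).
    rewrite -[RHS](s0 b bf); apply: eq_bigr => l _; rewrite /n1.
    case: ifPn => // /eqP rl; rewrite asboolF ?mulr0 // => lb; apply: rl.
    rewrite -jj; apply: rep_eq.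
    have sub j2 j3 : lexcone (s j2) b -> lexcone (s j3) b ->
        inspan (s j2) `<=` inspan (s j3).
      move=> h2 h3 x.
      have xb : inspan b x -> inspan (s j3) x.
        by move=> [w ->]; apply: inspan_comb => i; apply: lexcone_inspan h3.
      move=> xs; apply: xb; apply: contrapT => nxb.
      have xbf := lfree_fcons bf nxb.
      apply: (@not_lfree_span _ _ _ _ (s j2) (fcons x b)) xbf => // i.
      by case: (unliftP ord0 i) => [i'|] ->; rewrite ?fconsS ?fcons0 //; apply: lexcone_inspan h2.
    by apply/seteqP; split; apply: sub.
  rewrite big1 // => j _; rewrite /n1; case: ifPn => [/eqP rj|]; last by rewrite mul0r.
  by rewrite asboolF ?mulr0 // => jb; apply: nb; exists j.
pose o := s j1 ord0.
have /choice[a aP] j : exists a, rep j = j0 -> o = comb a (s j).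
  have [rj|] := pselect (rep j = j0); last by exists (fun=> 0).
  have : inspan (s j) o.
    by rewrite span1 ?rj //; exists (fun i => (i == ord0)%:R); rewrite comb_delta.
  by move=> [w wP]; exists w.
pose Psi (t : 'I_k -> E) := Phi (fcons o t).
pose n2 (ji : J * 'I_k.+1) := n1 ji.1 * sgz (a ji.1 ji.2).
pose s2 (ji : J * 'I_k.+1) := del (s ji.1) ji.2.
have red : \sum_j Phi (s j) *~ n1 j - \sum_ji Psi (s2 ji) *~ n2 ji \in M.
  rewrite -(pair_big predT predT (fun j i => Psi (s2 (j, i)) *~ n2 (j, i))) /=.
  rewrite -sumrB; apply: rpred_sum => j _.
  have [/eqP rj|rj] := boolP (rep j == j0); last first.
    rewrite /n2 /= /n1 (negPf rj) mulr0z sub0r rpredN big1 ?rpred0 // => i _.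
    by rewrite mul0r mulr0z.
  (* The dependency [- o + comb (a j) (s j) = 0] isolates [Phi (s j)], with coefficient -1, among
     cones with apex [o]. *)
  have := Phi_radon (fcons o (s j)) (fcons (-1) (a j)).
  rewrite comb_fcons -aP // scaleN1r addNr => /(_ _ erefl).
  rewrite sum_del_fcons sgzN1 mulrNz.
  move=> h.
  rewrite -rpredN opprB /n2 /s2 /=.
  under eq_bigr do rewrite mulrzA.
  rewrite (eq_bigr (fun i => (Phi (fcons o (del (s j) i)) *~ sgz (a j i)) *~ n1 j)); last first.
    by move=> i _; rewrite -!mulrzA mulrC.
  rewrite -mulrz_suml -mulrzBl rpredMz // addrC; apply: h.
  by move=> i; case: (unliftP ord0 i) => [i'|] ->; rewrite ?fconsS ?fcons0 //; apply: sQ.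
rewrite -[X in X \in _](subrK (\sum_ji Psi (s2 ji) *~ n2 ji)) rpredD //.
apply: IH.
- move=> p w pQ pw.
  (* The coefficient 0 at [o] kills the only term whose family lacks [o]. *)
  have := Phi_radon (fcons o p) (fcons 0 w).
  rewrite comb_fcons pw scale0r addr0 => /(_ _ erefl).
  rewrite sum_del_fcons sgz0 mulr0z add0r.
  by apply=> i; case: (unliftP ord0 i) => [i'|] ->; rewrite ?fconsS ?fcons0 //; apply: sQ.
- by move=> [j i]; apply: lfree_del.
- by move=> [j i] l; apply: sQ.
move=> b bf.
rewrite -(pair_big predT predT
  (fun j i => n2 (j, i) * (`[< lexcone (s2 (j, i)) b >] : int))) /=.
(* If [o] is in the span of [b], it is in the span of every facet whose cone contains [b], so the
   sign attached to that facet is 0. Otherwise the hypothesis is used at [b] extended by [o] and by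
   [- o], and the difference is given by [jump]. *)
have [ob|nob] := pselect (inspan b o).
  rewrite big1 // => j _; rewrite big1 // => i _; rewrite /n2 /s2 /= /n1.
  case: ifPn => [/eqP rj|]; last by rewrite !mul0r.
  have [h|h] := pselect (lexcone (del (s j) i) b); last by rewrite asboolF ?mulr0.
  have [w [e wi]] : exists w, o = comb w (s j) /\ w i = 0.
    apply: inspan_del; move: ob => [w ->]; apply: inspan_comb => l.
    exact: lexcone_inspan h.
  move: e; rewrite (aP j rj) => /(lfree_inj (sf j)) ->.
  by rewrite wi sgz0 mulr0 mul0r.
have e1 := s1 _ (lfree_fcons bf nob).
have e2 : \sum_j n1 j * (`[< lexcone (s j) (fcons (- o) b) >] : int) = 0.
  by apply/s1/lfree_fcons => // /inspanN; rewrite opprK.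
have := congr2 (fun x y : int => x - y) e1 e2; rewrite /= subrr => e3.
rewrite -[RHS]e3 -sumrB; apply: eq_bigr => j _; rewrite -mulrBr.
have [/eqP rj|rj] := boolP (rep j == j0); last first.
  by rewrite /n2 /= /n1 (negPf rj) mul0r big1 // => i _; rewrite !mul0r.
rewrite {1 2}(aP j rj) jump // mulr_sumr; apply: eq_bigr => i _.
by rewrite mulrA.
Qed.
End Chains.

(** * Radon relations *)

Section Radon.
Variables (R : realType) (E : lmodType R).

Definition upd T k (p : 'I_k -> T) i x : 'I_k -> T :=
  fun j => if j == i then x else p j.

Lemma upd_id T k (p : 'I_k -> T) i x : upd p i x i = x.
Proof. by rewrite /upd eqxx. Qed.

Lemma upd_neq T k (p : 'I_k -> T) i x j : j != i -> upd p i x j = p j.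
Proof. by rewrite /upd => /negPf ->. Qed.

Lemma del_upd T k (p : 'I_k.+1 -> T) i x : del (upd p i x) i = del p i.
Proof. by apply/funext => j; rewrite /del upd_neq // eq_sym neq_lift. Qed.

Lemma del_upd_lift T k (p : 'I_k.+1 -> T) l i x :
  del (upd p (lift l i) x) l = upd (del p l) i x.
Proof. by apply/funext => j; rewrite /del /upd (inj_eq lift_inj). Qed.

Lemma comb_upd k (w : 'I_k -> R) (p : 'I_k -> E) i x :
  comb w (upd p i x) = comb w p + w i *: (x - p i).
Proof.
rewrite /comb (bigD1 i) //= [in RHS](bigD1 i) //= upd_id scalerBr [RHS]addrC.
rewrite addrA subrK; congr (_ + _).
by apply: eq_bigr => j ji; rewrite upd_neq.
Qed.

Lemma sum_updE (V : zmodType) k (w : 'I_k -> V) i x :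
  \sum_j upd w i x j = \sum_j w j + (x - w i).
Proof.
rewrite (bigD1 i) //= [in RHS](bigD1 i) //= upd_id [RHS]addrC addrA subrK.
by congr (_ + _); apply: eq_bigr => j ji; rewrite upd_neq.
Qed.

Lemma comb_upd_coef k (w : 'I_k -> R) (p : 'I_k -> E) i x :
  comb (upd w i x) p = comb w p + (x - w i) *: p i.
Proof.
rewrite /comb (bigD1 i) //= [in RHS](bigD1 i) //= upd_id scalerBl [RHS]addrC.
rewrite addrA subrK; congr (_ + _).
by apply: eq_bigr => j ji; rewrite upd_neq.
Qed.

Lemma same_sign (x y : R) : 0 < x * y ->
  [/\ 0 < y / (x + y) < 1, sgz (x + y) = sgz x & sgz (x + y) = sgz y].
Proof.
move=> xy; case: (ltrgt0P x) => x0; last by rewrite x0 mul0r ltxx in xy.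
  have y0 : 0 < y by rewrite pmulr_rgt0 in xy.
  rewrite !gtr0_sgz ?addr_gt0 // divr_gt0 ?addr_gt0 // ltr_pdivrMr ?addr_gt0 //.
  by rewrite mul1r ltrDr.
have y0 : y < 0 by rewrite nmulr_rgt0 in xy.
have xy0 : x + y < 0 by rewrite -oppr_gt0 opprD addr_gt0 ?oppr_gt0.
rewrite !ltr0_sgz // -mulrNN -invrN divr_gt0 ?oppr_gt0 // ltr_pdivrMr ?oppr_gt0 //.
by rewrite mul1r opprD ltrDr oppr_gt0.
Qed.

Lemma merge0 (x y : R) (u v e : E) : (x + y) *: e = x *: u + y *: v ->
  (x + y) *: (e - u) + (y *: u - y *: v) = 0.
Proof.
move=> eP; rewrite scalerBr eP scalerDl opprD [X in X + _]addrACA subrr add0r.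
by rewrite addrA subrK subrr.
Qed.

(** The permutation is the transposition of [i] and [j], read on the remaining indices. *)
Lemma del_perm T k (p : 'I_k.+1 -> T) i j : p i = p j ->
  exists2 s : 'I_k -> 'I_k, bijective s & del p j = del p i \o s.
Proof.
move=> pij.
have nz (l m : 'I_k.+1) (x : 'I_k) : exists y, lift l y = tperm l m (lift m x).
  case: (unliftP l (tperm l m (lift m x))) => [y ->|]; first by exists y.
  rewrite -{2}(tpermR l m) => /perm_inj /eqP.
  by rewrite eq_sym (negPf (neq_lift _ _)).
have /choice[s sP] := nz i j.
have /choice[t tP] := nz j i.
exists s.
  by exists t => x; [apply: (@lift_inj _ j)|apply: (@lift_inj _ i)];
    rewrite ?tP ?sP ?tP tpermC tpermK.
apply/funext => x; rewrite /del /= sP.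
by case: tpermP => [->|->|].
Qed.

Section RadonM.
Variables (W : zmodType) (M : zmodClosed W).

(* Two points [p i], [p j] whose coefficients have the same sign are merged
   into a point [e] of the segment between them; splitting along [e] turns
   the relation of [p] into the relations of [p] with [p i], resp. [p j],
   replaced by [e], whose dependencies have smaller support. *)
Lemma radon_split k (Phi : ('I_k -> E) -> W) :
  (forall p s, bijective s -> Phi (p \o s) = Phi p) ->
  (forall p i j t, i != j -> 0 < t < 1 ->
     let e := (1 - t) *: p i + t *: p j in
     Phi p - Phi (upd p i e) - Phi (upd p j e) \in M) ->
  forall (p : 'I_k.+1 -> E) a, \sum_i a i = 0 -> comb a p = 0 ->
  \sum_i Phi (del p i) *~ sgz (a i) \in M.
Proof.
move=> Phi_perm Phi_split p a; have [r] := ubnP #|[pred i | a i != 0]|.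
elim: r p a => // r IH p a; rewrite ltnS => ar a0 pa.
have [[i [j [ij aij]]]|same] := pselect (exists i j, i != j /\ 0 < a i * a j).
  have ji : j != i by rewrite eq_sym.
  have c0 : a i + a j != 0.
    apply: contraTneq aij => /eqP; rewrite addr_eq0 => /eqP ->.
    by rewrite mulNr -leNgt oppr_le0 -expr2 sqr_ge0.
  pose t := a j / (a i + a j); pose e := (1 - t) *: p i + t *: p j.
  have [t01 sgi sgj] := same_sign aij.
  have eP : (a i + a j) *: e = a i *: p i + a j *: p j.
    rewrite /e scalerDr !scalerA /t mulrBr mulr1 mulrCA divff // mulr1 addrK //.
  (* The point [e] takes the weight of both points and the one that is kept gets 0, so the support
     shrinks. *)
  pose a1 := upd (upd a i (a i + a j)) j 0.
  pose a2 := upd (upd a j (a i + a j)) i 0.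
  have ai : a i != 0 by apply: contraTneq aij => ->; rewrite mul0r ltxx.
  have aj : a j != 0 by apply: contraTneq aij => ->; rewrite mulr0 ltxx.
  have R1 : \sum_l Phi (del (upd p i e) l) *~ sgz (a1 l) \in M.
    apply: IH.
    - apply: leq_trans ar; apply: proper_card; apply/properP; split.
        apply/fintype.subsetP => l; rewrite !inE /a1 /upd.
        case: (eqVneq l j) => _; first by rewrite eqxx.
        by case: (eqVneq l i) => [->|//]; rewrite ai.
      by exists j; rewrite !inE // /a1 upd_id eqxx.
    - rewrite /a1 !sum_updE a0 upd_neq 1?eq_sym // add0r addrC; ring.
    - have -> : a1 = upd (upd a i (a i + a j)) j 0 by [].
      rewrite comb_upd !comb_upd_coef pa (upd_neq _ _ ij) upd_id (upd_neq _ _ ji).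
      rewrite add0r [X in (X - a i) *: _]addrC addrK sub0r scaleNr addrC merge0 //.
  have R2 : \sum_l Phi (del (upd p j e) l) *~ sgz (a2 l) \in M.
    apply: IH.
    - apply: leq_trans ar; apply: proper_card; apply/properP; split.
        apply/fintype.subsetP => l; rewrite !inE /a2 /upd.
        case: (eqVneq l i) => _; first by rewrite eqxx.
        by case: (eqVneq l j) => [->|//]; rewrite aj.
      by exists i; rewrite !inE // /a2 upd_id eqxx.
    - rewrite /a2 !sum_updE a0 upd_neq // add0r; ring.
    - have -> : a2 = upd (upd a j (a i + a j)) i 0 by [].
      rewrite comb_upd !comb_upd_coef pa (upd_neq _ _ ji) upd_id (upd_neq _ _ ij).
      rewrite add0r addrK sub0r scaleNr addrC [a i + _]addrC merge0 //.
      by rewrite addrC eP addrC.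
  rewrite -[X in X \in _](subrK (\sum_l Phi (del (upd p i e) l) *~ sgz (a1 l))) rpredD //.
  rewrite -[X in X \in _](subrK (\sum_l Phi (del (upd p j e) l) *~ sgz (a2 l))) rpredD //.
  (* At [l = i] and [l = j] the terms cancel, since [a i + a j] has the common sign; any other facet
     contains both points and is split by [Phi_split]. *)
  rewrite -!sumrB; apply: rpred_sum => l _.
  have [->|li] := eqVneq l i.
    by rewrite /a1 /a2 (upd_neq _ _ ij) !upd_id sgz0 mulr0z subr0 sgi del_upd subrr rpred0.
  have [->|lj] := eqVneq l j.
    rewrite /a1 /a2 upd_id (upd_neq _ _ (_ : j != i)) 1?eq_sym // upd_id sgz0 mulr0z subr0.
    by rewrite sgj del_upd subrr rpred0.
  rewrite /a1 /a2 !upd_neq // -!mulrzBl rpredMz //.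
  case: (unliftP l i) (unliftP l j) li lj => [i' ei|-> ]; last by rewrite eqxx.
  case=> [j' ej|->] _; last by rewrite eqxx.
  move=> _; rewrite ei ej !del_upd_lift.
  have -> : e = (1 - t) *: del p l i' + t *: del p l j' by rewrite /e ei ej.
  by apply: Phi_split => //; move: ij; rewrite ei ej (inj_eq lift_inj).
(* Now at most one coefficient is positive and at most one negative. As they sum to 0, either all
   vanish or two opposite ones remain, on equal points, and the two terms cancel by [del_perm]. *)
have {}same i j : i != j -> a i * a j <= 0.
  by move=> ij; rewrite leNgt; apply/negP => h; apply: same; exists i, j.
have [i /= ai|az] := pickP (fun i => a i != 0); last first.
  by rewrite big1 ?rpred0 // => i _; have /negbFE/eqP -> := az i; rewrite sgz0 mulr0z.
have [j /andP[/= ji aj]|nj] := pickP (fun j => (j != i) && (a j != 0)); last first.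
  move: a0; rewrite (bigD1 i) //= big1 ?addr0 => [aiz|j ji]; first by rewrite aiz eqxx in ai.
  by have := nj j; rewrite ji /= => /negbFE/eqP.
have al l : l != i -> l != j -> a l = 0.
  move=> li lj; apply/eqP; apply: contraT => l0.
  have := same _ _ li; have := same _ _ lj; have := same _ _ ji.
  case: (ltrgt0P (a l)) l0 => // l0 _; rewrite ?(pmulr_rle0 _ l0) ?(nmulr_rle0 _ l0) => h1 h2 h3.
    have {}h2 : a j < 0 by rewrite lt_neqAle aj.
    by move: h1; rewrite (nmulr_rle0 _ h2) leNgt lt_neqAle ai h3.
  have {}h2 : 0 < a j by rewrite lt_neqAle eq_sym aj.
  by move: h1; rewrite (pmulr_rle0 _ h2) leNgt lt_neqAle eq_sym ai h3.
have ji' : a j = - a i.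
  move: a0; rewrite (bigD1 i) //= (bigD1 j) //= big1 ?addr0.
    by move/eqP; rewrite addrC addr_eq0 => /eqP.
  by move=> l /andP[li lj]; apply: al.
have pij : p i = p j.
  move: pa; rewrite /comb (bigD1 i) //= (bigD1 j) //= big1 ?addr0.
    rewrite ji' scaleNr -scalerBr => /eqP.
    by rewrite scaler_eq0 (negPf ai) subr_eq0 => /eqP.
  by move=> l /andP[li lj]; rewrite al // scale0r.
rewrite (bigD1 i) //= (bigD1 j) //= big1 ?addr0; last first.
  by move=> l /andP[li lj]; rewrite al // sgz0 mulr0z.
have [s sb ->] := del_perm pij.
by rewrite Phi_perm // ji' sgzN mulrNz subrr rpred0.
Qed.
End RadonM.
End Radon.

(** * Simplices in homogeneous coordinates *)

Section Mix.
Variables (R : realType) (E : lmodType R).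

Lemma comb_mix k (p : 'I_k -> E) i j t w : i != j ->
  comb w (upd p i ((1 - t) *: p i + t *: p j)) =
  comb (upd (upd w i ((1 - t) * w i)) j (w j + t * w i)) p.
Proof.
move=> ij; rewrite comb_upd !comb_upd_coef (upd_neq _ _ (_ : j != i)) 1?eq_sym //.
rewrite -[RHS]addrA; congr (_ + _).
rewrite [w j + _]addrC addrK addrAC -{2}[p i]scale1r -scalerBl.
rewrite scalerDr !scalerA; congr (_ *: _ + _ *: _); ring.
Qed.

Lemma lfree_mix k (p : 'I_k -> E) i j t : i != j -> t != 1 -> lfree p ->
  lfree (upd p i ((1 - t) *: p i + t *: p j)).
Proof.
move=> ij t1 pf w; rewrite comb_mix // => /pf h.
have wi : w i = 0.
  have := h i; rewrite upd_neq // upd_id => /eqP.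
  by rewrite mulf_eq0 subr_eq0 eq_sym (negPf t1) => /eqP.
move=> l; have := h l; rewrite /upd.
case: (eqVneq l j) => [->|lj]; first by rewrite wi mulr0 addr0.
by case: (eqVneq l i) => [->|].
Qed.

Lemma lfree_mixE k (p : 'I_k -> E) i j t : i != j -> t != 1 ->
  lfree (upd p i ((1 - t) *: p i + t *: p j)) <-> lfree p.
Proof.
move=> ij t1; split; last exact: lfree_mix.
have t1' : 1 - t != 0 by rewrite subr_eq0 eq_sym.
set q := upd _ _ _ => qf.
(* Mixing the new point with [p j] at parameter [t'], which lies outside the unit interval when
   [0 < t < 1], gives [p i] back. *)
pose t' := 1 - (1 - t)^-1.
have t'1 : t' != 1 by rewrite /t' -subr_eq0 addrAC subrr add0r oppr_eq0 invr_eq0.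
have := lfree_mix ij t'1 qf; set q' := upd _ _ _; suff -> : q' = p by [].
apply/funext => l; rewrite /q' {1}/upd.
case: (eqVneq l i) => [->|li]; last by rewrite /q upd_neq.
rewrite /q upd_id upd_neq 1?eq_sym // scalerDr !scalerA -addrA -scalerDl.
have -> : (1 - t') * (1 - t) = 1 by rewrite /t'; field.
have -> : (1 - t') * t + t' = 0 by rewrite /t'; field.
by rewrite scale1r scale0r addr0.
Qed.

Lemma lfree_perm k (p : 'I_k -> E) (s : 'I_k -> 'I_k) :
  bijective s -> lfree p -> lfree (p \o s).
Proof.
move=> [s' ss' s's] pf w e i.
rewrite -[i]ss' -/((w \o s') (s i)); apply: pf.
rewrite -[RHS]e /comb (reindex s) /=; last by exists s' => x _.
by apply: eq_bigr => l _; rewrite ss'.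
Qed.

End Mix.

Section Hulls.
Variables (R : realType) (N : nat).
Local Notation V := 'rV[R]_N.
Local Notation E := 'rV[R]_(1 + N).

(** At height 1, affine independence becomes linear independence and convex hulls become sections of
    cones. *)
Definition hat (x : V) : E := row_mx 1%:M x.
Definition hats k (v : 'I_k -> V) (i : 'I_k) : E := hat (v i).

Lemma comb_hat k w (v : 'I_k -> V) :
  comb w (hats v) = row_mx (\sum_i w i)%:M (comb w v).
Proof.
rewrite /comb; under eq_bigr do rewrite /hats /hat scale_row_mx scalemx1.
elim/big_ind3: _ => [|? a ? ? b ? -> ->|//];
  by rewrite ?raddf0 ?row_mx0 // raddfD add_row_mx.
Qed.

Lemma hat_comb k w (v : 'I_k -> V) x :
  hat x = comb w (hats v) <-> \sum_i w i = 1 /\ x = comb w v.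
Proof.
rewrite comb_hat; split=> [/eq_row_mx[+ ->]|[-> ->] //].
by move/matrixP/(_ 0 0); rewrite !mxE eqxx !mulr1n.
Qed.

Lemma conv_hullE k (v : 'I_k -> V) x :
  conv_hull v x <-> cone (hats v) (hat x).
Proof.
split=> [[w [w0 w1 xw]]|[w [w0 /hat_comb[w1 xw]]]]; exists w.
  by split=> //; apply/hat_comb.
by split.
Qed.

Lemma indepE k (v : 'I_k -> V) : affinely_independent v <-> lfree (hats v).
Proof.
split=> [vi w|vf w w0 wv].
  rewrite comb_hat -row_mx0 => /eq_row_mx[+ wv].
  by move/matrixP/(_ 0 0); rewrite !mxE mulr1n => w0; apply: vi.
by apply: vf; rewrite comb_hat w0 /comb wv raddf0 row_mx0.
Qed.

Lemma hats_del k (v : 'I_k.+1 -> V) i : hats (del v i) = del (hats v) i.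
Proof. by []. Qed.

Lemma indep_del k (v : 'I_k.+1 -> V) i :
  affinely_independent v -> affinely_independent (del v i).
Proof. by move=> /indepE vf; apply/indepE/(@lfree_del _ _ _ (hats v)). Qed.

Lemma hat_mix (t : R) x y : hat ((1 - t) *: x + t *: y) = (1 - t) *: hat x + t *: hat y.
Proof.
by rewrite /hat !scale_row_mx add_row_mx !scalemx1 -raddfD /= subrK.
Qed.

Lemma hats_upd k (v : 'I_k -> V) i x : hats (upd v i x) = upd (hats v) i (hat x).
Proof. by apply/funext => j; rewrite /hats /upd; case: eqP. Qed.

Lemma conv_hull_mem k (v : 'I_k -> V) i : conv_hull v (v i).
Proof.
apply/conv_hullE; exists (fun j => (j == i)%:R).
by rewrite comb_delta; split=> // j; case: eqP => _; rewrite ?ler01 ?lexx.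
Qed.

Lemma conv_hull_sub k l (v : 'I_k -> V) (u : 'I_l -> V) :
  (forall i, conv_hull v (u i)) -> conv_hull u `<=` conv_hull v.
Proof.
move=> h x /conv_hullE[w [w0 xw]].
have /choice[L HL] i := (conv_hullE v (u i)).1 (h i).
apply/conv_hullE; exists (fun j => \sum_i w i * L i j); split.
  by move=> j; apply: sumr_ge0 => i _; rewrite mulr_ge0 // (HL i).1.
rewrite xw /comb; under eq_bigr do rewrite /hats (HL _).2 /comb scaler_sumr.
rewrite exchange_big; apply: eq_bigr => j _ /=.
by rewrite scaler_suml; apply: eq_bigr => i _; rewrite scalerA.
Qed.

Lemma conv_hull_del k (v : 'I_k.+1 -> V) i : conv_hull (del v i) `<=` conv_hull v.
Proof. by apply: conv_hull_sub => j; apply: conv_hull_mem. Qed.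

Section Split.
Variables (k : nat) (v : 'I_k.+1 -> V) (i j : 'I_k.+1) (t : R).
Hypotheses (ij : i != j) (t01 : 0 < t < 1).
Let e := (1 - t) *: v i + t *: v j.

Lemma indep_split : affinely_independent (upd v i e) <-> affinely_independent v.
Proof.
rewrite !indepE hats_upd hat_mix; apply: lfree_mixE => //.
by case/andP: t01 => _ t1; rewrite lt_eqF.
Qed.

Lemma conv_split_sub : conv_hull (upd v i e) `<=` conv_hull v.
Proof.
apply: conv_hull_sub => l; have [->|li] := eqVneq l i; last first.
  by rewrite upd_neq //; apply: conv_hull_mem.
rewrite upd_id; apply/conv_hullE.
case/andP: t01 => t0 t1.
exists (fun l => (1 - t) * (l == i)%:R + t * (l == j)%:R); split.
  by move=> m; rewrite addr_ge0 // mulr_ge0 ?ler0n ?subr_ge0 // ltW.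
by rewrite combD !combZ !comb_delta hat_mix.
Qed.
End Split.

Lemma conv_split k (v : 'I_k.+1 -> V) i j t : i != j -> 0 < t < 1 ->
  let e := (1 - t) *: v i + t *: v j in
  conv_hull v = conv_hull (upd v i e) `|` conv_hull (upd v j e).
Proof.
move=> ij t01 e; have ji : j != i by rewrite eq_sym.
have eE : e = (1 - (1 - t)) *: v j + (1 - t) *: v i by rewrite subKr addrC.
have t01' : 0 < 1 - t < 1 by rewrite subr_gt0 ltrBlDr ltrDl andbC.
case/andP: (t01) => t0 t1; case/andP: (t01') => t0' t1'.
apply/seteqP; split=> [x|x [|]]; last 2 first.
- exact: conv_split_sub.
- by rewrite eE; apply: conv_split_sub.
move=> /conv_hullE[w [w0 xw]].
(* Comparing the ratio of [w i] to [w j] with that of the weights of [e] tells the half; [e] then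
   carries all the weight of the vertex it replaces. *)
have [h|h] := leP (t * w i) ((1 - t) * w j); [left|right]; apply/conv_hullE.
- exists (upd (upd w i (w i / (1 - t))) j (w j - t * (w i / (1 - t)))); split.
    move=> l; rewrite /upd; case: eqP => _; last by case: eqP => // _; rewrite divr_ge0 // ltW.
    by rewrite subr_ge0 mulrA ler_pdivrMr // mulrC [w j * _]mulrC mulrC.
  rewrite hats_upd hat_mix comb_mix // xw; congr comb; apply/funext => l; rewrite /upd.
  rewrite eqxx (negPf ij) eqxx.
  case: (eqVneq l j) => [->|lj]; first by rewrite subrK.
  by case: (eqVneq l i) => [->|//]; rewrite mulrC divfK // gt_eqF.
- exists (upd (upd w j (w j / t)) i (w i - (1 - t) * (w j / t))); split.
    move=> l; rewrite /upd; case: eqP => _; last by case: eqP => // _; rewrite divr_ge0 // ltW.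
    by rewrite subr_ge0 mulrA ler_pdivrMr // [w i * _]mulrC ltW.
  rewrite eE hats_upd hat_mix comb_mix // xw; congr comb; apply/funext => l; rewrite /upd.
  rewrite eqxx (negPf ji) eqxx.
  case: (eqVneq l i) => [->|li]; first by rewrite subrK.
  by case: (eqVneq l j) => [->|//]; rewrite subKr mulrC divfK // gt_eqF.
Qed.

Lemma conv_splitI k (v : 'I_k.+1 -> V) i j t : i != j -> 0 < t < 1 ->
  affinely_independent v ->
  let e := (1 - t) *: v i + t *: v j in
  conv_hull (upd v i e) `&` conv_hull (upd v j e) = conv_hull (del (upd v i e) j).
Proof.
move=> ij t01 vi e; have ji : j != i by rewrite eq_sym.
have eE : e = (1 - (1 - t)) *: v j + (1 - t) *: v i by rewrite subKr addrC.
case/andP: (t01) => t0 t1.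
apply/seteqP; split=> [x []|x xd]; last first.
  split; first exact: conv_hull_del xd.
  move: x xd; apply: conv_hull_sub => l; rewrite /del.
  case: (eqVneq (lift j l) i) => [->|li]; rewrite ?upd_id ?(upd_neq v _ li).
    by have := conv_hull_mem (upd v j e) j; rewrite upd_id.
  have := conv_hull_mem (upd v j e) (lift j l).
  by rewrite upd_neq // eq_sym neq_lift.
move=> /conv_hullE[w [w0 xw]] /conv_hullE[w' [w'0 xw']].
have E : upd (upd w' j ((1 - (1 - t)) * w' j)) i (w' i + (1 - t) * w' j) =
         upd (upd w i ((1 - t) * w i)) j (w j + t * w i).
  move/indepE: vi => /lfree_inj; apply.
  by rewrite -!comb_mix // -!hat_mix -eE -!hats_upd -xw -xw'.
(* Comparing coordinates at [i] and [j] makes [(1 - t) * w j] equal to [- (t * w' i)], so both are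
   0. *)
have wj : w j = 0.
  have := congr1 (@^~ i) E; have := congr1 (@^~ j) E.
  rewrite /upd !eqxx (negPf ij) (negPf ji) subKr => E1 E2.
  have e1 : (1 - t) * w j = - (t * w' i) by nra.
  have t1' : 0 < 1 - t by rewrite subr_gt0.
  apply/eqP; rewrite eq_le w0 andbT -(pmulr_rle0 _ t1') e1 oppr_le0.
  by rewrite mulr_ge0 // ltW.
apply/conv_hullE; exists (del w j); split=> [l|]; first exact: w0.
by rewrite xw (comb_del _ _ j) wj scale0r add0r.
Qed.

End Hulls.

(** * Dissection by hyperplanes *)

Lemma mulmx_col (R : pzSemiRingType) m n p (A : 'M[R]_(m, n)) (B : 'M_(n, p)) j :
  A *m col j B = col j (A *m B).
Proof. by rewrite !colE mulmxA. Qed.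

Section Linear.
Variables (R : realType) (D : nat).
Local Notation E := 'rV[R]_D.

Lemma comb_mx k w (p : 'I_k -> E) : comb w p = (\row_i w i) *m (\matrix_i p i).
Proof. by rewrite mulmx_sum_row; apply: eq_bigr => i _; rewrite mxE rowK. Qed.

Lemma lfree_row_free k (p : 'I_k -> E) : lfree p -> row_free (\matrix_i p i).
Proof.
move=> pf; rewrite -kermx_eq0; apply/rowV0P => u /sub_kermxP uP.
apply/rowP => i; rewrite mxE; apply: (pf (fun i => u 0 i)).
by rewrite comb_mx -[RHS]uP; congr (_ *m _); apply/rowP => j; rewrite mxE.
Qed.

Lemma inspanP k (p : 'I_k -> E) x : inspan p x <-> x *m cokermx (\matrix_i p i) = 0.
Proof.
split=> [[w ->]|].
  by rewrite comb_mx -mulmxA mulmx_coker mulmx0.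
move=> /eqP; rewrite -submxE => /submxP[u ->].
by exists (fun i => u 0 i); rewrite comb_mx; congr (_ *m _); apply/rowP => j; rewrite mxE.
Qed.

Definition halfspaces (l : seq 'cV[R]_D) : set E :=
  [set x | all (fun c => 0 <= (x *m c) 0 0) l].

Lemma halfspaces_cat l l' : halfspaces (l ++ l') = halfspaces l `&` halfspaces l'.
Proof.
by apply/seteqP; split=> x; rewrite /halfspaces /= all_cat => /andP.
Qed.

(** The columns of the cokernel, with both signs, force a point into the span; those of the
    pseudo-inverse make its coordinates nonnegative. *)
Lemma cone_halfspaces k (p : 'I_k -> E) : lfree p ->
  exists l, halfspaces l = cone p.
Proof.
move=> /lfree_row_free; set P := \matrix_i p i => Pf.
pose C := cokermx P.
exists ([seq col i (pinvmx P) | i : 'I_k] ++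
        ([seq col i C | i : 'I_D] ++ [seq - col i C | i : 'I_D])).
apply/seteqP; split=> x; rewrite /halfspaces /= !all_cat.
  move=> /andP[/allP h1 /andP[/allP h2 /allP h3]].
  have xC : x *m C = 0.
    apply/rowP => i; rewrite [RHS]mxE; apply/eqP; rewrite eq_le.
    have := h2 (col i C); have := h3 (- col i C).
    rewrite mulmxN !mulmx_col !mxE oppr_ge0 => -> //.
      by move=> ->; rewrite // fintype.image_f.
    by rewrite (fintype.image_f (fun i => - col i C)).
  exists (fun i => (x *m pinvmx P) 0 i); split=> [i|].
    have := h1 (col i (pinvmx P)).
    by rewrite mulmx_col [col _ _ _ _]mxE; apply; rewrite fintype.image_f.
  have xP : (x <= P)%MS by rewrite submxE xC.
  rewrite comb_mx -{1}(mulmxKpV xP); congr (_ *m _).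
  by apply/rowP => i; rewrite [RHS]mxE.
move=> [w [w0 ->]]; rewrite comb_mx; set r := \row_i _.
have rC : r *m P *m C = 0 by rewrite -mulmxA mulmx_coker mulmx0.
apply/and3P; split; apply/allP => c /mapP[i _ ->].
- by rewrite mulmx_col mulmxKp // !mxE.
- by rewrite mulmx_col rC !mxE.
- by rewrite mulmxN mulmx_col rC !mxE oppr0.
Qed.

End Linear.

Section Dissection.
Variables (R : realType) (N : nat).
Local Notation V := 'rV[R]_N.
Local Notation C := 'cV[R]_(1 + N).

Definition aff (c : C) (x : V) : R := (hat x *m c) 0 0.

Lemma aff_comb c k w (v : 'I_k -> V) x : hat x = comb w (hats v) ->
  aff c x = \sum_i w i * aff c (v i).
Proof.
rewrite /aff => ->; rewrite /comb mulmx_suml summxE.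
by apply: eq_bigr => i _; rewrite -scalemxAl mxE.
Qed.

Lemma aff_mix c t x y : aff c ((1 - t) *: x + t *: y) = (1 - t) * aff c x + t * aff c y.
Proof. by rewrite /aff hat_mix mulmxDl -!scalemxAl !mxE. Qed.

Definition onesided k (v : 'I_k -> V) c :=
  (forall i, 0 <= aff c (v i)) \/ (forall i, aff c (v i) <= 0).

Lemma onesided_mix k (v : 'I_k -> V) c i j t : 0 < t < 1 -> onesided v c ->
  onesided (upd v i ((1 - t) *: v i + t *: v j)) c.
Proof.
move=> /andP[t0 t1]; have t1' : 0 <= 1 - t by rewrite subr_ge0 ltW.
case=> h; [left|right] => l; rewrite /upd; case: eqP => // _; rewrite aff_mix.
  by rewrite addr_ge0 // mulr_ge0 // ltW.
by rewrite -oppr_ge0 opprD -!mulrN addr_ge0 // mulr_ge0 ?oppr_ge0 // ltW.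
Qed.

Definition split_closed k (P : ('I_k -> V) -> Prop) :=
  forall v i j t, affinely_independent v -> i != j -> 0 < t < 1 ->
  let e := (1 - t) *: v i + t *: v j in P (upd v i e) -> P (upd v j e) -> P v.

(** An edge joining vertices strictly on opposite sides is cut where it meets the hyperplane; each
    half has fewer vertices off the hyperplane. *)
Lemma dissect1 k c (P : ('I_k.+1 -> V) -> Prop) :
  split_closed P ->
  (forall v, affinely_independent v -> onesided v c -> P v) ->
  forall v, affinely_independent v -> P v.
Proof.
move=> Ps Pc v; have [r] := ubnP #|[pred i | aff c (v i) != 0]|.
elim: r v => // r IH v; rewrite ltnS => vr vi.
have [[i [j [ci cj]]]|no] :=
  pselect (exists i j, aff c (v i) < 0 /\ 0 < aff c (v j)); last first.
  apply: Pc => //; have [[i ci]|ni] := pselect (exists i, aff c (v i) < 0).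
    by right=> j; rewrite leNgt; apply/negP => cj; apply: no; exists i, j.
  by left=> i; rewrite leNgt; apply/negP => ci; apply: ni; exists i.
have ij : i != j by apply: contraTneq ci => ->; rewrite -leNgt ltW.
have ji : j != i by rewrite eq_sym.
set x := aff c (v i) in ci; set y := aff c (v j) in cj.
(* The zero of [aff c] on the edge from [v i] to [v j]. *)
pose t := x / (x - y).
have xy : x - y < 0 by rewrite subr_lt0 (lt_trans ci).
have t01 : 0 < t < 1.
  rewrite /t -mulrNN -invrN divr_gt0 ?oppr_gt0 // ltr_pdivrMr ?oppr_gt0 //.
  by rewrite mul1r opprB ltrDr.
pose e := (1 - t) *: v i + t *: v j.
have e0 : aff c e = 0.
  by rewrite aff_mix -/x -/y /t; field; rewrite lt_eqF.
have eE : e = (1 - (1 - t)) *: v j + (1 - t) *: v i by rewrite subKr addrC.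
have t01' : 0 < 1 - t < 1.
  by case/andP: t01 => t0 t1; rewrite subr_gt0 ltrBlDr ltrDl t0 t1.
have card l : aff c (v l) != 0 ->
    (#|[pred i | aff c (upd v l e i) != 0%R]| < r)%N.
  move=> cl; apply: leq_trans vr; apply: proper_card; apply/properP; split.
    apply/fintype.subsetP => m; rewrite !inE /upd.
    by case: (eqVneq m l) => [_|//]; rewrite e0 eqxx.
  by exists l; rewrite !inE ?cl // upd_id e0 eqxx.
apply: (Ps v i j t) => //; apply: IH.
- by apply: card; rewrite lt_eqF.
- exact/indep_split.
- by apply: card; rewrite gt_eqF.
- by rewrite -/e eE; apply/indep_split.
Qed.

(** One hyperplane at a time: by [onesided_mix] a cut along [c] keeps the pieces on one side of the
    hyperplanes of [l], which [P'] records. *)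
Lemma dissect k (l : seq C) (P : ('I_k.+1 -> V) -> Prop) :
  split_closed P ->
  (forall v, affinely_independent v -> (forall c, c \in l -> onesided v c) -> P v) ->
  forall v, affinely_independent v -> P v.
Proof.
move=> Ps; elim: l => [|c l IH] Pl v vi; first by apply: Pl.
apply: IH => // {vi}v vi vl.
pose P' u := (forall c, c \in l -> onesided u c) -> P u.
suff : P' v by apply.
apply: (@dissect1 _ c) vi => [u i j t ui ij t01 e P1 P2 ul|u ui uc ul]; last first.
  by apply: Pl => // d; rewrite inE => /orP[/eqP ->|/ul].
apply: (Ps u i j t) => //.
  by apply: P1 => d dl; apply: onesided_mix => //; apply: ul.
apply: P2 => d dl; rewrite /e.
rewrite [(1 - t) *: _ + _]addrC -{1}[t](subKr 1).
apply: onesided_mix; last exact: ul.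
by case/andP: t01 => t0 t1; rewrite subr_gt0 ltrBlDr ltrDl t0 t1.
Qed.

Definition Hset (l : seq C) : set V := [set x | halfspaces l (hat x)].

Lemma Hset_cat l l' : Hset (l ++ l') = Hset l `&` Hset l'.
Proof. by rewrite /Hset halfspaces_cat. Qed.

Lemma HsetP l x : Hset l x <-> forall c, c \in l -> 0 <= aff c x.
Proof. by split=> [/allP //|h]; apply/allP. Qed.

(** The index counts vertices, one more than the dimension, so that the empty simplex has index
    0. *)
Definition spx k : set (set V) :=
  [set A | exists v : 'I_k -> V, affinely_independent v /\ A = conv_hull v].

Definition spxle k : set (set V) := [set A | exists2 j, (j <= k)%N & spx j A].

Lemma spx_Hset k A : spx k A -> exists l, A = Hset l.
Proof.
move=> [v [/indepE vf ->]]; have [l lE] := cone_halfspaces vf.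
exists l; apply/seteqP; split=> x; rewrite /Hset lE; first by move/conv_hullE.
by move=> h; apply/conv_hullE.
Qed.

Lemma conv_hull0 (v : 'I_0 -> V) : conv_hull v = set0.
Proof.
by rewrite -subset0 => x [w [_]]; rewrite big_ord0 => /eqP; rewrite eq_sym oner_eq0.
Qed.

Lemma spxle_set0 k : spxle k set0.
Proof.
exists 0%N => //; exists (fun=> 0); split; first by move=> w _ _ [].
by rewrite conv_hull0.
Qed.

Lemma bigcup_ord_recl T m (A : 'I_m.+1 -> set T) :
  \bigcup_(i in [set: 'I_m.+1]) A i =
  A ord0 `|` \bigcup_(i in [set: 'I_m]) A (lift ord0 i).
Proof.
apply/seteqP; split=> [x [i _]|x [Ax|[i _ Ax]]]; last 2 first.
- by exists ord0.
- by exists (lift ord0 i).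
by case: (unliftP ord0 i) => [j|] -> Ax; [right; exists j|left].
Qed.

Lemma bigcup_ord0 T (A : 'I_0 -> set T) : \bigcup_(i in [set: 'I_0]) A i = set0.
Proof. by rewrite -subset0 => x [[]]. Qed.

(** A point where [aff c] is nonnegative can put no weight on [v i]. *)
Lemma cap_face k (v : 'I_k.+1 -> V) l c i : c \in l ->
  (forall j, aff c (v j) <= 0) -> aff c (v i) < 0 ->
  Hset l `&` conv_hull v = Hset l `&` conv_hull (del v i).
Proof.
move=> cl vc vi; apply/seteqP; split=> x [xl xv]; split=> //; last first.
  exact: conv_hull_del xv.
move/conv_hullE: xv => [w [w0 xw]]; have := (HsetP l x).1 xl c cl.
rewrite (aff_comb c xw) => h.
have wi : w i = 0.
  apply/eqP; rewrite eq_le w0 andbT leNgt; apply/negP => wi.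
  move: h; rewrite leNgt => /negP; apply.
  rewrite (bigD1 i) //= -[ltRHS]addr0 ltr_leD ?pmulr_rlt0 //.
  by apply: sumr_le0 => j _; rewrite mulr_ge0_le0.
apply/conv_hullE; exists (del w i); split=> [j|]; first exact: w0.
by rewrite xw (comb_del _ _ i) wi scale0r add0r.
Qed.

(** * Induction over unions of simplices cut by half-spaces *)

Section PolyInd.
Variables (k0 : nat) (good : set V -> Prop).
Hypothesis good_spx : forall A, spxle k0 A -> good A.
Hypothesis goodU : forall A B, good A -> good B -> good (A `&` B) -> good (A `|` B).

(** Simplices come with half-spaces because [goodU] also asks for intersections, and meeting such a
    union with a simplex gives a union of the same form. *)
Definition good_caps k := forall m (K : 'I_m -> seq C) (F : 'I_m -> set V),
  (forall i, spxle k (F i)) -> good (\bigcup_(i in [set: 'I_m]) (Hset (K i) `&` F i)).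

Lemma good_set0 : good set0.
Proof. exact/good_spx/spxle_set0. Qed.

Lemma good_capS k : (k.+1 <= k0)%N -> good_caps k ->
  forall m (K : 'I_m -> seq C) (v : 'I_k.+1 -> V), affinely_independent v ->
  good ((\bigcup_(i in [set: 'I_m]) Hset (K i)) `&` conv_hull v).
Proof.
move=> kk0 IH m K; set X := \bigcup_(i in _) _.
have XE A : X `&` A = \bigcup_(i in [set: 'I_m]) (Hset (K i) `&` A).
  by rewrite setI_bigcupl.
apply: (@dissect _ (flatten [seq K i | i : 'I_m])) => [v i j t vi ij t01 e h1 h2|v vi vl].
  rewrite (conv_split _ ij t01) -/e setIUr; apply: goodU => //.
  (* The two halves overlap in a simplex with one vertex less. *)
  rewrite setIACA setIid (conv_splitI ij t01 vi) -/e XE.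
  apply: IH => _; exists k => //; exists (del (upd v i e) j); split=> //.
  by apply/indep_del/indep_split.
have vK i c : c \in K i -> onesided v c.
  by move=> cK; apply: vl; apply/flattenP; exists (K i) => //; apply: fintype.image_f.
(* A one-sided piece either lies in some [Hset (K i)], hence in [X], or meets each of them only in a
   proper face, which has fewer vertices. *)
have [[i iK]|no] := pselect (exists i, forall c j, c \in K i -> 0 <= aff c (v j)).
  suff -> : X `&` conv_hull v = conv_hull v.
    by apply: good_spx; exists k.+1 => //; exists v.
  apply/setIidr => x xv; exists i => //; apply/HsetP => c cK.
  move/conv_hullE: xv => [w [w0 /(aff_comb c) ->]].
  by apply: sumr_ge0 => j _; rewrite mulr_ge0 // iK.
have /choice[f fP] i : exists j,
    Hset (K i) `&` conv_hull v = Hset (K i) `&` conv_hull (del v j).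
  have /existsNP[c /existsNP[j /not_implyP[cK /negP]]] :
      ~ forall c j, c \in K i -> 0 <= aff c (v j).
    by move=> h; apply: no; exists i.
  rewrite -ltNge => cj; exists j; apply: (cap_face cK) => //.
  by case: (vK _ _ cK) => // /(_ j); rewrite leNgt cj.
rewrite XE; under eq_bigcupr do rewrite fP.
apply: IH => i; exists k => //; exists (del v (f i)); split=> //.
exact: indep_del.
Qed.

Lemma good_capsP k : (k <= k0)%N -> good_caps k.
Proof.
elim: k => [|k IH] kk0; rewrite /good_caps.
  move=> m K F hF; rewrite bigcup0 => [|i _]; first exact: good_set0.
  by have [j] := hF i; rewrite leqn0 => /eqP -> [v [_ ->]]; rewrite conv_hull0 setI0.
have {}IH := IH (ltnW kk0).
have cap1 m (K : 'I_m -> seq C) S : spxle k.+1 S ->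
    good ((\bigcup_(i in [set: 'I_m]) Hset (K i)) `&` S).
  move=> [j]; rewrite leq_eqVlt => /predU1P[->|jk] Sj.
    by case: Sj => v [vi ->]; apply: good_capS.
  by rewrite setI_bigcupl; apply: IH => _; exists j.
elim=> [|m IHm] K F hF; first by rewrite bigcup_ord0; apply: good_set0.
rewrite bigcup_ord_recl; apply: goodU.
- by have := cap1 1%N (fun=> K ord0) _ (hF ord0); rewrite bigcup_const //; exists ord0.
- exact: IHm.
(* Writing the other simplices as intersections of half-spaces turns the overlap into caps of the
   single simplex [F ord0]. *)
have /choice[H HP] i : exists l, F (lift ord0 i) = Hset l.
  by have [j _ /spx_Hset] := hF (lift ord0 i).
have := cap1 m (fun i => (K (lift ord0 i) ++ H i) ++ K ord0) _ (hF ord0).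
congr good; rewrite setI_bigcupl setI_bigcupr; apply: eq_bigcupr => i _.
by rewrite !Hset_cat -HP -setIA setIC.
Qed.

End PolyInd.
End Dissection.

(** * Carathéodory's theorem and dimension *)

Section FiniteUnions.
Variable T : Type.

Definition funion (S : set (set T)) (A : set T) := exists m (F : 'I_m -> set T),
  (forall i, S (F i)) /\ A = \bigcup_(i in [set: 'I_m]) F i.

Lemma funion_fin (S : set (set T)) (J : finType) (F : J -> set T) :
  (forall j, S (F j)) -> funion S (\bigcup_(j in [set: J]) F j).
Proof.
move=> SF; exists #|J|, (fun i => F (enum_val i)); split=> //.
apply/seteqP; split=> x [j _ Fx]; last by exists (enum_val j).
by exists (enum_rank j); rewrite ?enum_rankK.
Qed.

Lemma funion_bind (S S' : set (set T)) A :
  (forall B, S B -> funion S' B) -> funion S A -> funion S' A.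
Proof.
move=> SS' [m [F [SF ->]]].
pose mi i := projT1 (cid (SS' _ (SF i))).
pose G i := projT1 (cid (projT2 (cid (SS' _ (SF i))))).
have GP i : (forall j, S' (G i j)) /\ F i = \bigcup_(j in [set: 'I_(mi i)]) G i j.
  exact: (projT2 (cid (projT2 (cid (SS' _ (SF i)))))).  
suff -> : \bigcup_(i in [set: 'I_m]) F i =
    \bigcup_(x in [set: {i : 'I_m & 'I_(mi i)}]) G (tag x) (tagged x).
  by apply: funion_fin => -[i j]; apply: (GP i).1.
apply/seteqP; split=> [x [i _]|x [[i j] _ Gx]].
  by rewrite (GP i).2 => -[j _ Gx]; exists (Tagged (fun i => 'I_(mi i)) j).
by exists i => //; rewrite (GP i).2; exists j.
Qed.

Lemma funion1 (S : set (set T)) A : S A -> funion S A.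
Proof.
by move=> SA; exists 1%N, (fun=> A); rewrite bigcup_const //; exists ord0.
Qed.

Lemma funionW (S S' : set (set T)) A : S `<=` S' -> funion S A -> funion S' A.
Proof. by move=> SS'; apply: funion_bind => B /SS'/funion1. Qed.

Lemma funionU (S : set (set T)) A B : funion S A -> funion S B -> funion S (A `|` B).
Proof.
move=> SA SB; apply: (@funion_bind (funion S)) => //.
suff -> : A `|` B = \bigcup_(b in [set: bool]) (if b then A else B).
  by apply: funion_fin => -[].
apply/seteqP; split=> [x [Ax|Bx]|x [[] _ xx]].
- by exists true.
- by exists false.
- by left.
- by right.
Qed.

End FiniteUnions.

Section Caratheodory.
Variables (R : realType) (N : nat).
Local Notation V := 'rV[R]_N.

Lemma caratheodory_step k (v : 'I_k.+1 -> V) : ~ affinely_independent v ->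
  conv_hull v = \bigcup_(i in [set: 'I_k.+1]) conv_hull (del v i).
Proof.
move=> /indepE /existsNP[a /not_implyP[av /existsNP[i /eqP ai]]].
apply/seteqP; split=> [x /conv_hullE[w [w0 xw]]|x [j _]]; last exact: conv_hull_del.
have a0 : \sum_i a i = 0.
  by move: av; rewrite comb_hat -row_mx0 => /eq_row_mx[/matrixP/(_ 0 0)]; rewrite !mxE.
have [i0 i0P] : exists i, 0 < a i.
  apply: contrapT => h; have /psumr_eq0P h' : forall i, true -> 0 <= - a i.
    by move=> l _; rewrite oppr_ge0 leNgt; apply/negP => al; apply: h; exists l.
  move: ai; rewrite -oppr_eq0 h' ?eqxx //.
  by rewrite sumrN a0 oppr0.
pose f i := w i / a i.
(* The largest multiple of the dependency that can be subtracted with all weights staying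
   nonnegative; it brings that of [j] to 0. *)
case: (@Order.TotalTheory.arg_minP _ _ _ i0 (fun i => 0 < a i) f i0P) => j aj jmin.
exists j => //; apply/conv_hullE.
pose w' l := w l + - (f j * a l).
have w'j : w' j = 0 by rewrite /w' /f divfK ?subrr // gt_eqF.
exists (del w' j); split=> [l|]; last first.
  rewrite hats_del -[comb _ _]add0r -(scale0r (hats v j)) -w'j -comb_del.
  by rewrite combD combN combZ av scaler0 subr0.
rewrite /del /w' subr_ge0; have [al|al] := ltP 0 (a (lift j l)).
  by rewrite -ler_pdivlMr //; apply: jmin.
apply: le_trans (w0 _); rewrite mulr_ge0_le0 // /f divr_ge0 // ltW //.
Qed.

(** The pieces stay in the hull, so that a bound on its dimension bounds their numbers of
    vertices. *)
Lemma caratheodory k (v : 'I_k -> V) :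
  funion (fun B => B `<=` conv_hull v /\ exists j, spx j B) (conv_hull v).
Proof.
elim: k v => [|k IH] v; have [vi|vd] := pselect (affinely_independent v).
- by apply: funion1; split=> //; exists 0%N, v.
- by exfalso; apply: vd => w _ _ [].
- by apply: funion1; split=> //; exists k.+1, v.
rewrite {2}(caratheodory_step vd).
apply: (@funion_bind _ (fun B => exists i, B = conv_hull (del v i))).
  move=> _ [i ->]; apply: funionW (IH _) => B [Bd]; split=> //.
  exact: subset_trans (@conv_hull_del _ _ _ v i).
by apply: funion_fin => i; exists i.
Qed.

Lemma sub_affine_hull (A : set V) : A `<=` affine_hull A.
Proof.
move=> x Ax; exists 1%N, (fun=> x), (fun=> 1); split=> //.
  by rewrite big_ord1.
by rewrite big_ord1 scale1r.
Qed.

(** The differences with [v ord0] are free and lie in the direction space [U]. *)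
Lemma indep_dim k (v : 'I_k -> V) n A : affinely_independent v ->
  (forall i, A (v i)) -> dim_le n A -> (k <= n.+1)%N.
Proof.
case: k v => // k v vi Av [A0|[p [U [AU Un]]]].
  by move: (Av ord0); rewrite A0.
have vU i : v i - p \in U by have := sub_affine_hull (Av i); rewrite AU.
rewrite ltnS; apply: leq_trans Un.
pose u := [tuple v (lift ord0 i) - v ord0 | i < k].
have uf : free u.
  apply/freeP => c cu i.
  have := vi (fcons (- \sum_i c i) c); rewrite !big_ord_recl fcons0.
  under [X in - _ + X]eq_bigr do rewrite fconsS.
  rewrite addNr => /(_ erefl); under [X in _ + X]eq_bigr do rewrite fconsS.
  move=> /(_ _ (lift ord0 i)); rewrite fconsS; apply.
  rewrite -[RHS]cu scaleNr scaler_suml addrC -sumrB; apply: eq_bigr => l _.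
  by rewrite -tnth_nth tnth_mktuple scalerBr.
have <- : \dim <<u>> = k by move/eqP: uf => ->; rewrite size_tuple.
apply/dimvS/span_subvP => _ /mapP[i _ ->].
by rewrite -[X in X \in _](subrKA p) rpredD // -rpredN opprB.
Qed.

(** The affine hull is the translate by [v ord0] of the span of the [k - 1] differences, when [k] is
    positive. *)
Lemma spx_dim_le n k (A : set V) : (k <= n.+1)%N -> spx k A -> dim_le n A.
Proof.
case: k => [_ [v [_ ->]]|k kn [v [_ ->]]]; first by left; apply: conv_hull0.
right.
have [u uE] : exists u : k.-tuple V, forall i : 'I_k, u`_i = v (lift ord0 i) - v ord0.
  exists [tuple v (lift ord0 i) - v ord0 | i < k] => i.
  by rewrite -tnth_nth tnth_mktuple.
exists (v ord0), <<u>>%VS; split; last by rewrite (leq_trans (dim_span _)) // size_tuple.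
have vU i : v i - v ord0 \in <<u>>%VS.
  case: (unliftP ord0 i) => [j|] ->; last by rewrite subrr mem0v.
  by rewrite -uE memv_span // mem_nth // size_tuple.
have wU l (w : 'I_l -> R) (y : 'I_l -> V) : \sum_i w i = 1 ->
    (forall i, y i - v ord0 \in <<u>>%VS) -> (\sum_i w i *: y i) - v ord0 \in <<u>>%VS.
  move=> w1 yU; rewrite -[X in _ - X]scale1r -w1 scaler_suml -sumrB.
  by apply: rpred_sum => i _; rewrite -scalerBr rpredZ.
apply/seteqP; split=> [_ [l [y [w [yv w1 ->]]]]|x /= xU].
  by apply: (wU) => // i; case: (yv i) => c [_ c1 ->]; apply: wU.
have [c xc] : exists c, x - v ord0 = \sum_(i < k) c i *: (v (lift ord0 i) - v ord0).
  exists (fun i => coord u i (x - v ord0)).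
  rewrite {1}(coord_span xU).
  by apply: eq_bigr => i _; rewrite uE.
exists k.+1, v, (fcons (1 - \sum_i c i) c); split.
- by move=> i; apply: conv_hull_mem.
- by rewrite big_ord_recl fcons0 [X in _ + X](eq_bigr c) ?subrK // => i _; rewrite fconsS.
rewrite big_ord_recl fcons0 scalerBl scale1r -addrA -[LHS](subrK (v ord0)) [LHS]addrC.
congr (_ + _); rewrite xc scaler_suml [RHS]addrC -sumrB; apply: eq_bigr => i _.
by rewrite fconsS scalerBr.
Qed.

Lemma simplicesE n : simplices n = spxle n.+1 :> set (set V).
Proof.
apply/seteqP; split=> [A [[k [v [vi ->]]] dA]|A [j jn Aj]].
  by exists k; [apply: (indep_dim vi) dA; apply: conv_hull_mem|exists v].
by split; [case: Aj => v [vi ->]; exists j, v|apply: spx_dim_le Aj].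
Qed.

Lemma polyhedraE n : polyhedra n = funion (spxle n.+1) :> set (set V).
Proof.
apply/seteqP; split=> [A [m [P [hP ->]]]|A [m [F [hF ->]]]]; last first.
  exists m, F; split=> // i; have := hF i; rewrite -simplicesE => -[[k [v [_ e]]]].
  by split=> //; exists k, v.
apply: (@funion_bind _ (fun B => exists i, B = P i)); last first.
  by apply: funion_fin => i; exists i.
move=> _ [i ->]; have [[k [v ->]] dv] := hP i.
apply: funionW (caratheodory v) => B [Bv [j [u [ui Bu]]]].
exists j; last by exists u.
by apply: (indep_dim ui) dv => l; apply: Bv; rewrite Bu; apply: conv_hull_mem.
Qed.

End Caratheodory.

(** * Germs and the group of chains *)

Section Germs.
Variable R : realType.

Definition small (P : R -> Prop) := exists2 d, 0 < d & forall x, 0 < x < d -> P x.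

Lemma smallT (P : R -> Prop) : (forall x, P x) -> small P.
Proof. by move=> h; exists 1. Qed.

Lemma small_and P Q : small P -> small Q -> small (fun x => P x /\ Q x).
Proof.
move=> [d d0 dP] [d' d'0 d'P]; exists (Num.min d d'); first by rewrite lt_min d0.
move=> x /andP[x0]; rewrite lt_min => /andP[xd xd']; split.
  by apply: dP; rewrite x0.
by apply: d'P; rewrite x0.
Qed.

Lemma small_imp P Q : (forall x, P x -> Q x) -> small P -> small Q.
Proof. by move=> PQ [d d0 dP]; exists d => // x /dP/PQ. Qed.

Lemma small_all (J : finType) (P : J -> R -> Prop) :
  (forall j, small (P j)) -> small (fun x => forall j, P j x).
Proof.
move=> h; have : small (fun x => forall j, j \in enum J -> P j x).
  elim: (enum J) => [|j s IH]; first exact: smallT.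
  apply: small_imp (small_and (h j) IH) => x [Pj Ps] i.
  by rewrite inE => /orP[/eqP ->|/Ps].
by apply: small_imp => x Px j; apply: Px; rewrite mem_enum.
Qed.

Lemma small_ex P : small P -> exists2 x, 0 < x & P x.
Proof.
move=> [d d0 dP]; exists (d / 2); first by rewrite divr_gt0.
by apply: dP; rewrite divr_gt0 // ltr_pdivrMr // mulr_natr mulr2n ltrDl.
Qed.

Definition gcoef m (x : R) (f : 'I_m -> R) : R := \sum_(j < m) x ^+ (m - j) * f j.

(** After division by [x ^+ (m - j0)], entries above [j0] vanish and those below contribute at most
    [x * S] in absolute value, less than [f j0]. *)
Lemma lexpos_small m (f : 'I_m -> R) : lexpos f -> small (fun x => 0 < gcoef x f).
Proof.
move=> [j0 [fj0 z]]; pose S := 1 + \sum_j `|f j|.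
have S0 : 0 < S by rewrite ltr_pwDl // sumr_ge0.
exists (Num.min 1 (f j0 / S)); first by rewrite lt_min ltr01 divr_gt0.
move=> x /andP[x0]; rewrite lt_min => /andP[x1]; rewrite ltr_pdivlMr // => xS.
rewrite /gcoef (bigD1 j0) //= -ltrBlDr sub0r -sumrN.
apply: (@le_lt_trans _ _ (\sum_(j | j != j0) x ^+ (m - j0) * (x * `|f j|))).
  apply: ler_sum => j jj0; have [jlt|] := ltnP j j0; last first.
    rewrite leq_eqVlt => /orP[/eqP e|/z ->].
      by rewrite (val_inj e) eqxx in jj0.
    by rewrite normr0 !mulr0 oppr0.
  have -> : (m - j = (m - j0) + 1 + (j0 - j).-1)%N by have := ltn_ord j0; lia.
  rewrite -mulrN !exprD expr1 -!mulrA ler_pM2l ?exprn_gt0 //.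
  rewrite ler_pM2l // (le_trans (ler_norm _)) // normrM normrN.
  by rewrite ler_piMl // ger0_norm ?exprn_ge0 ?exprn_ile1 // ltW.
rewrite -mulr_sumr ltr_pM2l ?exprn_gt0 // -mulr_sumr.
apply: le_lt_trans xS; rewrite ler_pM2l // /S (bigD1 j0 (P := predT)) //=.
by rewrite addrA lerDr addr_ge0.
Qed.

Lemma gcoefN m x (f : 'I_m -> R) : gcoef x (fun j => - f j) = - gcoef x f.
Proof. by rewrite /gcoef -sumrN; apply: eq_bigr => j _; rewrite mulrN. Qed.

Lemma nonzero_small m (f : 'I_m -> R) : (exists j, f j <> 0) ->
  small (fun x => gcoef x f != 0).
Proof.
move=> [j fj]; case: (lexpos_or f) => [/(_ j) //|h|h].
  by apply: small_imp (lexpos_small h) => x; apply: lt0r_neq0.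
apply: small_imp (lexpos_small h) => x; rewrite gcoefN => /lt0r_neq0.
by rewrite oppr_eq0.
Qed.

Variable D : nat.
Local Notation E := 'rV[R]_D.

(* [x^m b_0 + ... + x b_(m-1)]: as [x] tends to [0+], each [b_j] is
   infinitesimal compared to [b_(j+1)], as in [lexpos]. *)
Definition germ m (b : 'I_m -> E) x : E := comb (fun j : 'I_m => x ^+ (m - j)) b.

Lemma germ_comb k m (s : 'I_k -> E) (b : 'I_m -> E) L x :
  (forall j, b j = comb (L j) s) ->
  germ b x = comb (fun i => gcoef x (fun j => L j i)) s.
Proof.
move=> HL; rewrite /germ {1}/comb; under eq_bigr do rewrite HL /comb scaler_sumr.
rewrite exchange_big; apply: eq_bigr => i _ /=.
by rewrite scaler_suml; apply: eq_bigr => j _; rewrite scalerA.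
Qed.

(** Some column of the cokernel does not vanish at some [b j]; along the germ it is a nonzero
    polynomial in [x]. *)
Lemma germ_notin_span k m (s : 'I_k -> E) (b : 'I_m -> E) :
  ~ (forall j, inspan s (b j)) -> small (fun x => ~ inspan s (germ b x)).
Proof.
move=> /existsNP[j]; rewrite inspanP => bj.
have [c bc] : exists c, (b j *m cokermx (\matrix_i s i)) 0 c <> 0.
  by apply/existsNP => h; apply: bj; apply/rowP => c; rewrite h mxE.
apply: small_imp (nonzero_small (ex_intro _ j bc)) => x /eqP h.
rewrite inspanP => /matrixP/(_ 0 c); rewrite [RHS]mxE => h'; apply: h.
rewrite -[RHS]h' /germ /comb mulmx_suml summxE.
by apply: eq_bigr => l _; rewrite -scalemxAl [RHS]mxE.
Qed.

(** Infinitesimal positions become actual points. In the span of [s], a coordinate that is not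
    [lexpos] is lexicographically negative, since [k] free vectors cannot all have it zero. *)
Lemma lexcone_small k (s : 'I_k -> E) (b : 'I_k -> E) : lfree s -> lfree b ->
  small (fun x => cone s (germ b x) <-> lexcone s b).
Proof.
move=> sf bf; have [/choice[L HL]|bs] := pselect (forall j, inspan s (b j)); last first.
  apply: small_imp (germ_notin_span bs) => x nx; split.
    by move=> [w [_ xw]]; case: nx; exists w.
  by move=> sb; case: bs => j; apply: lexcone_inspan sb.
have [Lp|] := pselect (forall i, lexpos (fun j => L j i)).
  apply: small_imp (small_all (fun i => lexpos_small (Lp i))) => x xp; split=> _.
    by exists L.
  exists (fun i => gcoef x (fun j => L j i)); split; last exact: germ_comb.
  by move=> i; apply/ltW/xp.
move=> /existsNP[i Li].
have {}Li' : lexpos (fun j => - L j i).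
  case: (lexpos_or (fun j => L j i)) => // Lz; exfalso.
  case: k => [|k] in s b sf bf L HL i Li Lz *; first by case: i Li Lz.
  apply: (@not_lfree_span _ _ _ _ (del s i) b) bf => // j.
  by exists (del (L j) i); rewrite HL (comb_del _ _ i) Lz scale0r add0r.
apply: small_imp (lexpos_small Li') => x; rewrite gcoefN oppr_gt0 => xn.
rewrite (lexconeE sf HL); split=> [[w [w0]]|/(_ i) //].
rewrite (germ_comb _ HL) => /(lfree_inj sf) /(congr1 (@^~ i)) e.
by move: xn; rewrite e ltNge w0.
Qed.

End Germs.

(** * Chains are determined by their indicator functions *)

Section ChainGroup.
Variables (R : realType) (N : nat).
Local Notation V := 'rV[R]_N.

Definition ind (A : set V) (x : V) : int := `[< A x >].

Lemma indU A B : ind A + ind B = ind (A `|` B) + ind (A `&` B).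
Proof.
apply/funext => x; change (ind A x + ind B x = ind (A `|` B) x + ind (A `&` B) x).
by rewrite /ind asbool_or asbool_and; case: `[< A x >]; case: `[< B x >].
Qed.

Variables (K : nat) (m : set V -> R).
Hypothesis m0 : m set0 = 0.
Hypothesis m_val : forall A B, spxle K A -> spxle K B ->
  spxle K (A `|` B) -> spxle K (A `&` B) -> m A + m B = m (A `|` B) + m (A `&` B).

Definition W : zmodType := ((V -> int) * R)%type.

Definition gen (A : set V) : W := (ind A, m A).

(* The subgroup of [W] generated by the [gen S], [S] a simplex with at most [k]
   vertices, with the simplices sorted by their number of vertices. *)
Fixpoint chains k : W -> Prop :=
  if k is k'.+1 then fun w =>
    exists (J : finType) (n : J -> int) (v : J -> 'I_k'.+1 -> V),
      (forall j, affinely_independent (v j)) /\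
      chains k' (w - \sum_j gen (conv_hull (v j)) *~ n j)
  else fun w => w = 0.

Lemma chains0 k : chains k 0.
Proof.
elim: k => //= k IH; exists void, (fun=> 0), (fun=> fun=> 0); split; first by case.
by rewrite big1 ?subr0 // => -[].
Qed.

Lemma chainsB k w w' : chains k w -> chains k w' -> chains k (w - w').
Proof.
elim: k w w' => /= [_ _ -> ->|k IH w w']; first by rewrite subr0.
move=> [J [n [v [vi wv]]]] [J' [n' [v' [vi' wv']]]].
exists (J + J')%type, (fun j => match j with inl j => n j | inr j => - n' j end),
  (fun j => match j with inl j => v j | inr j => v' j end).
split; first by case.
rewrite big_sumType /= [X in _ - (_ + X)](_ : _ = - \sum_j gen (conv_hull (v' j)) *~ n' j).
  by rewrite opprB [X in _ + X]addrC addrACA [- w' + _]addrC -[X in _ + X]opprB; apply: IH.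
by rewrite -sumrN; apply: eq_bigr => j _; rewrite mulrNz.
Qed.

Lemma chainsD k w w' : chains k w -> chains k w' -> chains k (w + w').
Proof.
move=> cw cw'; have -> : w + w' = w - (0 - w') by rewrite sub0r opprK.
by apply: chainsB cw (chainsB (chains0 k) cw').
Qed.

Definition chains_pred k : {pred W} := fun w => `[< chains k w >].

Fact chains_zmod_closed k : zmod_closed (chains_pred k).
Proof.
split=> [|w w' /asboolP h /asboolP h']; apply/asboolP; first exact: chains0.
exact: chainsB.
Qed.

HB.instance Definition _ k :=
  GRing.isZmodClosed.Build W (chains_pred k) (chains_zmod_closed k).

Lemma chainsP k w : reflect (chains k w) (w \in chains_pred k).
Proof. exact: asboolP. Qed.

Lemma chainsS k w : chains k w -> chains k.+1 w.
Proof.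
move=> h; exists void, (fun=> 0), (fun=> fun=> 0); split; first by case.
by rewrite big1 ?subr0 // => -[].
Qed.

Lemma gen_set0 : gen set0 = 0.
Proof. by rewrite /gen m0; congr (_, _); apply/funext => x; rewrite /ind asboolF. Qed.

Lemma gen_chains k A : spxle k A -> chains k (gen A).
Proof.
move=> [j jk Aj]; elim: k jk => [|k IH] jk.
  have {Aj} [v [_ ->]] : spx 0 A by move: jk Aj; rewrite leqn0 => /eqP ->.
  by rewrite conv_hull0 gen_set0.
move: jk; rewrite leq_eqVlt => /predU1P[jk|/IH/chainsS //].
move: Aj; rewrite jk => -[v [vi ->]]; exists unit, (fun=> 1), (fun=> v); split=> //.
by rewrite big_const card_unit /= addr0 mulr1z subrr; apply: chains0.
Qed.

Lemma genU A B : m A + m B = m (A `|` B) + m (A `&` B) ->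
  gen A + gen B = gen (A `|` B) + gen (A `&` B).
Proof.
move=> mAB; congr (_, _) => //; exact: indU.
Qed.

Definition ev x (w : W) : int := w.1 x.
Arguments ev : simpl never.

Fact ev_is_zmod_morphism x : zmod_morphism (ev x).
Proof. by []. Qed.

HB.instance Definition _ x :=
  GRing.isZmodMorphism.Build W int (ev x) (ev_is_zmod_morphism x).

(** The value 0 on dependent families respects splitting, since by [indep_split] a family and its
    two halves are independent together. *)
Definition Phi k (q : 'I_k -> V) : W :=
  if `[< affinely_independent q >] then gen (conv_hull q) else 0.

Lemma Phi_perm k (q : 'I_k -> V) (s : 'I_k -> 'I_k) : bijective s -> Phi (q \o s) = Phi q.
Proof.
move=> sb; have [s' ss' s's] := sb.
have cE : conv_hull (q \o s) = conv_hull q.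
  apply/seteqP; split; apply: conv_hull_sub => i; first exact: conv_hull_mem.
  by rewrite -[i]s's; apply: (conv_hull_mem (q \o s)).
rewrite /Phi cE; congr (if _ then _ else _); apply: asbool_equiv_eq.
rewrite !indepE; split=> h; last exact: (lfree_perm (p := hats q)).
have -> : hats q = hats (q \o s) \o s'.
  by apply/funext => i; rewrite /hats /= s's.
by apply: lfree_perm h; exists s.
Qed.

(** By the valuation property the defect is, up to sign, the generator of the common face of the
    halves, which has [k] vertices. *)
Lemma Phi_split k (q : 'I_k.+1 -> V) i j t : (k.+1 <= K)%N -> i != j -> 0 < t < 1 ->
  let e := (1 - t) *: q i + t *: q j in
  Phi q - Phi (upd q i e) - Phi (upd q j e) \in chains_pred k.
Proof.
move=> kK ij t01 /=; set e := (1 - t) *: q i + t *: q j; have ji : j != i by rewrite eq_sym.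
have eE : e = (1 - (1 - t)) *: q j + (1 - t) *: q i by rewrite subKr addrC.
have t01' : 0 < 1 - t < 1.
  by case/andP: t01 => t0 t1; rewrite subr_gt0 ltrBlDr ltrDl t0 t1.
have si := indep_split q ij t01.
have sj : affinely_independent (upd q j e) <-> affinely_independent q.
  by rewrite eE; apply: indep_split.
rewrite /Phi (asbool_equiv_eq si) (asbool_equiv_eq sj).
have [qi|qi] := pselect (affinely_independent q); last by rewrite (asboolF qi) !subr0 rpred0.
rewrite (asboolT qi).
have spxK (u : 'I_k.+1 -> V) : affinely_independent u -> spxle K (conv_hull u).
  by move=> ui; exists k.+1 => //; exists u.
have di : spxle k (conv_hull (del (upd q i e) j)).
  by exists k => //; exists (del (upd q i e) j); split=> //; apply/indep_del/si.
have eI := conv_splitI ij t01 qi; have eU := conv_split q ij t01.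
have := @genU (conv_hull (upd q i e)) (conv_hull (upd q j e)).
rewrite -eU eI => h; rewrite -addrA -opprD h ?opprD ?addrA ?subrr ?sub0r ?rpredN.
  exact/chainsP/gen_chains.
rewrite eU -eI; apply: m_val; rewrite -?eU ?eI.
- exact/spxK/si.
- exact/spxK/sj.
- exact: spxK.
by case: di => l lk dl; exists l => //; apply: leq_trans lk (ltnW kK).
Qed.

Lemma ev_gen z A : ev z (gen A) = `[< A z >].
Proof. by []. Qed.

Lemma conv_coneE k (v : 'I_k -> V) h z : 0 < h ->
  conv_hull v z <-> cone (hats v) (h *: hat z).
Proof.
move=> h0; rewrite conv_hullE; split=> -[w [w0 e]].
  by exists (fun i => h * w i); rewrite combZ -e; split=> // i; rewrite mulr_ge0 // ltW.
exists (fun i => h^-1 * w i); rewrite combZ -e scalerA mulVf ?gt_eqF // scale1r.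
by split=> // i; rewrite mulr_ge0 // invr_ge0 ltW.
Qed.

(** At most [k] vertices cannot span [M] free vectors, so the germ avoids the span of every simplex
    involved. *)
Lemma chains_small k M y (b : 'I_M -> 'rV[R]_(1 + N)) : (k < M)%N -> lfree b ->
  chains k y -> small (fun x => forall h z, germ b x = h *: hat z -> ev z y = 0).
Proof.
move=> + bf; elim: k y => [y _ -> | k IH y kM [J [n [v [vi yv]]]]].
  by apply: smallT => x h z _.
have s1 j : small (fun x => ~ inspan (hats (v j)) (germ b x)).
  by apply: germ_notin_span => h; apply: not_lfree_span h bf.
apply: small_imp (small_and (IH _ (ltnW kM) yv) (small_all s1)) => x [Px nx] h z e.
have yE : ev z (y - \sum_j gen (conv_hull (v j)) *~ n j) = 0 by apply: Px e.
move/eqP: yE; rewrite raddfB subr_eq0 => /eqP ->.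
rewrite raddf_sum big1 // => j _; rewrite raddfMz /= ev_gen asboolF ?mul0rz //.
move=> /conv_hullE[w [_ zw]]; apply: (nx j).
by exists (fun i => h * w i); rewrite e zw combZ.
Qed.

(** The germ has positive coordinates on points of height 1, so rescaling it gives a point of the
    affine space. *)
Lemma small_height M (b : 'I_M.+1 -> 'rV[R]_(1 + N)) (v : 'I_M.+1 -> V) :
  lexcone (hats v) b ->
  small (fun x => exists h z, 0 < h /\ germ b x = h *: hat z).
Proof.
move=> [L [HL Lp]].
apply: small_imp (small_all (fun i => lexpos_small (Lp i))) => x xp.
set c := fun i => gcoef x (fun j => L j i).
exists (\sum_i c i), ((\sum_i c i)^-1 *: comb c v).
have c0 : 0 < \sum_i c i.
  by rewrite big_ord_recl ltr_pwDl ?xp // sumr_ge0 // => i _; apply/ltW/xp.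
split=> //; rewrite (germ_comb _ HL) comb_hat /hat scale_row_mx scalemx1 scalerA.
by rewrite mulfV ?gt_eqF // scale1r.
Qed.

(** It suffices that the top layer [S] already lies in [chains k], by [chain_vanish]. Its
    cancellation hypothesis is tested at a point [z] on the germ of [b]: there [f] and the lower
    layers vanish, and membership in the top simplices is that of [b] in their cones. *)
Theorem chains_inj k f t : (k <= K)%N -> chains k (f, t) -> (forall z, f z = 0) -> t = 0.
Proof.
move=> + + f0; elim: k => [_ [//]|k IH kK ft]; apply: IH; first exact: ltnW.
have [J [n [v [vi]]]] := ft.
set S := \sum_j _ => ySk.
suff : S \in chains_pred k.
  move=> Sk; apply/chainsP; rewrite -[(f, t)](subrK S) rpredD //; exact/chainsP.
pose Psi (p : 'I_k.+1 -> 'rV[R]_(1 + N)) := Phi (fun i => rsubmx (p i)).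
have PsiE (q : 'I_k.+1 -> V) : Psi (hats q) = Phi q.
  by congr Phi; apply/funext => i; rewrite /hats /hat row_mxKr.
have -> : S = \sum_j Psi (hats (v j)) *~ n j.
  by apply: eq_bigr => j _; rewrite PsiE /Phi asboolT.
apply: (@chain_vanish _ _ _ _ (fun x => exists z, x = hat z)).
- move=> p a /choice[q pq]; have {p pq} -> : p = hats q by apply/funext => i; rewrite pq.
  rewrite comb_hat -row_mx0 => /eq_row_mx[/matrixP/(_ 0 0)]; rewrite !mxE mulr1n => a0 aq.
  have := @radon_split _ _ _ (chains_pred k) k.+1 (@Phi k.+1) _ _ q a a0 aq.
  under eq_bigr do rewrite -PsiE; apply.
    by move=> *; apply: Phi_perm.
  by move=> *; apply: Phi_split.
- by move=> j; apply/indepE.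
- by move=> j i; exists (v j i).
(* If no cone contains [b] the sum is trivially 0; otherwise one that does gives the germ positive
   height. *)
move=> b bf; have [[j0 j0b]|nb] := pselect (exists j, lexcone (hats (v j)) b); last first.
  by rewrite big1 // => j _; rewrite asboolF ?mulr0 // => jb; apply: nb; exists j.
have vf j : lfree (hats (v j)) by apply/indepE.
have /small_ex[x x0 [[h [z [h0 xz]]] [xc xy]]] :=
  small_and (small_height j0b) (small_and (small_all (fun j => lexcone_small (vf j) bf))
    (chains_small (ltnSn k) bf ySk)).
have := xy h z xz; rewrite raddfB /= [ev z (f, t)]f0 sub0r => /eqP; rewrite oppr_eq0 => /eqP Sz.
rewrite -[RHS]Sz raddf_sum; apply: eq_bigr => j _; rewrite raddfMz /= ev_gen -mulrzl intz.
congr (_ * _%:Z); congr nat_of_bool; apply: asbool_equiv_eq.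
by rewrite -xc xz -conv_coneE.
Qed.

End ChainGroup.

(** * Extension *)

Section Extension.
Variables (R : realType) (N : nat).
Local Notation V := 'rV[R]_N.

Lemma funion_spx_ind k (good : set V -> Prop) :
  (forall A, spxle k A -> good A) ->
  (forall A B, good A -> good B -> good (A `&` B) -> good (A `|` B)) ->
  forall A, funion (spxle k) A -> good A.
Proof.
move=> good_spx goodU A [m [F [hF ->]]].
(* An empty list of half-spaces imposes no condition. *)
have := good_capsP good_spx goodU (leqnn k) (fun=> [::]) hF.
congr good; apply: eq_bigcupr => i _; apply: setIidr => x _.
exact/HsetP.
Qed.

Section Chains.
Variables (K : nat) (m : set V -> R).
Hypothesis m0 : m set0 = 0.
Hypothesis m_val : forall A B, spxle K A -> spxle K B ->
  spxle K (A `|` B) -> spxle K (A `&` B) -> m A + m B = m (A `|` B) + m (A `&` B).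

Lemma funion_chains A : funion (spxle K) A -> exists t, chains m K (ind A, t).
Proof.
apply: (@funion_spx_ind _ (fun A => exists t, chains m K (ind A, t))) => {}A.
  by move=> Ak; exists (m A); apply: gen_chains.
move=> B [tA cA] [tB cB] [tI cI]; exists (tA + tB - tI).
rewrite (_ : (_, _) = ((ind A, tA) : W R N) + (ind B, tB) - (ind (A `&` B), tI)).
  by apply/chainsP; rewrite rpredB ?rpredD //; apply/chainsP.
congr (_, _); apply/eqP; rewrite eq_sym subr_eq; apply/eqP; exact: indU.
Qed.

Lemma chains_uniq f t t' : chains m K (f, t) -> chains m K (f, t') -> t = t'.
Proof.
move=> c c'; apply/eqP; rewrite -subr_eq0; apply/eqP.
apply: (chains_inj m0 m_val (leqnn K) (chainsB c c')) => z.
exact: subrr (f z).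
Qed.

End Chains.
End Extension.

Theorem theorem2 (R : realType) (N n : nat) (n_ge1 : (1 <= n)%N)
    (n_leN : (n <= N)%N) (mu : @simplices R N n -> R) (mu_val : valuation mu) :
  exists! mubar : @polyhedra R N n -> R,
    valuation mubar /\
    forall T : @simplices R N n, mubar (simplex_polyhedron T) = mu T.
Proof.
(* [mu] is made total, with value 0 off the simplices. *)
pose m (A : set 'rV[R]_N) : R :=
  if pselect (A \in simplices n) is left h then mu (SigSub h) else 0.
have mE A (h : A \in simplices n) : m A = mu (SigSub h).
  by rewrite /m; case: pselect => [h'|//]; rewrite (bool_irrelevance h h').
have memS (A : set 'rV[R]_N) : spxle n.+1 A -> A \in simplices n.
  by move=> h; apply/mem_set; rewrite simplicesE.
have m0 : m set0 = 0.
  by have h := mem_set (simplices_set0 R N n); rewrite (mE _ h); apply: mu_val.1.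
have m_val A B : spxle n.+1 A -> spxle n.+1 B -> spxle n.+1 (A `|` B) ->
    spxle n.+1 (A `&` B) -> m A + m B = m (A `|` B) + m (A `&` B).
  move=> /memS hA /memS hB /memS hU /memS hI.
  rewrite (mE _ hA) (mE _ hB) (mE _ hU) (mE _ hI).
  exact: (mu_val.2 (SigSub hA) (SigSub hB)).
have polyP (A : @polyhedra R N n) : funion (spxle n.+1) (val A).
  by rewrite -polyhedraE; apply: set_valP.
have /choice[mubar mubarP] (A : @polyhedra R N n) := funion_chains m0 (polyP A).
have mubarE A t : chains m n.+1 (ind (val A), t) -> mubar A = t.
  exact: (chains_uniq m0 m_val (mubarP A)).
have mubar_mu (T : @simplices R N n) : mubar (simplex_polyhedron T) = mu T.
  have h : val T \in simplices n := valP T.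
  have -> : mu T = m (val T) by rewrite (mE _ h); congr mu; apply: val_inj.
  apply/mubarE/(gen_chains m0).
  by rewrite -simplicesE; exact: (set_valP T).
have [mubar0 mubarU] : valuation mubar.
  split=> [h|A B hU hI].
    by apply: mubarE; rewrite -m0; apply: (gen_chains m0 (@spxle_set0 _ _ _)).
  apply/eqP; rewrite -subr_eq eq_sym; apply/eqP; apply: mubarE.
  rewrite (_ : (_, _) = ((ind (val A), mubar A) : W R N) + (ind (val B), mubar B) -
    (ind (val A `&` val B), mubar (SigSub hI))).
    exact: chainsB (chainsD (mubarP A) (mubarP B)) (mubarP (SigSub hI)).
  congr (_, _); apply/eqP; rewrite eq_sym subr_eq; apply/eqP; exact: indU.
exists mubar; split=> //.
move=> mu' [[_ mu'U] mu'T]; apply/funext => A.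
(* Membership is part of the property because both functions live on polyhedra only. Agreement on
   two sets and their intersection passes to the union. *)
pose good B := exists h : B \in polyhedra n, mubar (SigSub h) = mu' (SigSub h).
suff [h e] : good (val A) by have -> : A = SigSub h by apply: val_inj.
apply: (@funion_spx_ind _ _ n.+1 good) (polyP A) => {A} [A As|A B [hA eA] [hB eB] [hI eI]].
  pose T : @simplices R N n := SigSub (memS A As).
  exists (valP (simplex_polyhedron T)).
  have -> : SigSub (valP (simplex_polyhedron T)) = simplex_polyhedron T by apply: val_inj.
  by rewrite mubar_mu mu'T.
have hU : A `|` B \in polyhedra n.
  by apply/mem_set; rewrite polyhedraE; apply: funionU; rewrite -polyhedraE; apply/set_mem.
exists hU; apply: (@addIr _ (mubar (SigSub hI))).
by rewrite -(mubarU (SigSub hA) (SigSub hB)) eA eB eI; apply: (mu'U (SigSub hA) (SigSub hB)).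
Qed.
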